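(* Let $n\ge1$. For every $s>0$, there exists a constant $C_s>0$ such that, for every $f,g\in L^2(\mathbb{H}^n)$, $$\|\,|Q|^s\,V_gf\|_2^2+\|\,|P|^s\,V_gf\|_2^2\ge C_s\,\|f\|_2^2\,\|g\|_2^2.$$
   Context: $\mathbb{H}^n=\mathbb{R}^n\times\mathbb{R}^n\times\mathbb{R}\cong\mathbb{R}^{2n+1}$ is the Heisenberg group with group law $(p,q,t)\cdot(p',q',t')=\left(p+p',q+q',t+t'+\tfrac12(pq'-qp')\right)$, where $pq$ is the Euclidean dot product on $\mathbb{R}^n$. Its Haar measure is Lebesgue measure on $\mathbb{R}^{2n+1}$, so $L^2(\mathbb{H}^n)=L^2(\mathbb{R}^{2n+1})$. $\mathcal{F}$ is the Euclidean Fourier transform on $\mathbb{R}^{2n+1}$, $\mathcal{F}(h)(Q)=\int_{\mathbb{R}^{2n+1}}h(X)e^{-2\pi i\langle Q,X\rangle}\,dX$, extended to a unitary operator on $L^2(\mathbb{R}^{2n+1})$; here $\langle Q,X\rangle$ is the Euclidean inner product on $\mathbb{R}^{2n+1}$. The short-time Fourier transform of $f\in L^2(\mathbb{H}^n)$ with window $g\in L^2(\mathbb{H}^n)$ is $$V_gf(Q,P)=\int_{\mathbb{R}^{2n+1}}\mathcal{F}(f)(X)\,\overline{\mathcal{F}(g)(X\cdot P)}\,e^{-2\pi i\langle Q,X\rangle}\,dX,\qquad Q,P\in\mathbb{H}^n,$$ with $X\cdot P$ the Heisenberg product. $|Q|,|P|$ denote Euclidean norms in $\mathbb{R}^{2n+1}$;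 the norms on the left are $L^2(\mathbb{H}^n\times\mathbb{H}^n)$ norms (possibly $+\infty$) of the functions $(Q,P)\mapsto|Q|^sV_gf(Q,P)$ and $(Q,P)\mapsto|P|^sV_gf(Q,P)$. *)

(* Defs.v *)
From HB Require Import structures.
From mathcomp Require Import all_boot all_order all_algebra.
From mathcomp Require Import complex.
From mathcomp Require Import all_classical all_reals all_analysis.

Set Implicit Arguments.
Unset Strict Implicit.
Unset Printing Implicit Defensive.

Import Order.TTheory GRing.Theory Num.Theory.
Import numFieldNormedType.Exports.
Import ComplexField.Normc.

Local Open Scope classical_set_scope.
Local Open Scope ring_scope.

(** [m1 \x m2] under a name of its own: the library's sigma-finite instance
    for [\x] is only inferred for products of subprobabilities. *)

Section sigma_finite_product.
Context d1 d2 (T1 : measurableType d1) (T2 : measurableType d2) (R : realType).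
Variable m1 : {sigma_finite_measure set T1 -> \bar R}.
Variable m2 : {sigma_finite_measure set T2 -> \bar R}.

Definition sf_prod : set (T1 * T2) -> \bar R := (m1 \x m2)%E.

HB.instance Definition _ := Measure.on sf_prod.

Let sf_prod_sigma_finite : sigma_finite setT sf_prod.
Proof.
have /sigma_finiteP[F [TF ndF Foo]] := sigma_finiteT m1.
have /sigma_finiteP[G [TG ndG Goo]] := sigma_finiteT m2.
exists (fun n => F n `*` G n).
  rewrite -setXTT TF TG predeqE => -[x y]; split.
    move=> [/= [n _ Fnx] [k _ Gky]]; exists (maxn n k) => //; split.
    - by move: x Fnx; exact/subsetPset/ndF/leq_maxl.
    - by move: y Gky; exact/subsetPset/ndG/leq_maxr.
  by move=> [n _ []/= ? ?]; split; exists n.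
move=> k; have [? ?] := Foo k; have [? ?] := Goo k.
split; first exact: measurableX.
by rewrite /sf_prod product_measure1E// lte_mul_pinfty// ge0_fin_numE.
Qed.

HB.instance Definition _ := Measure_isSigmaFinite.Build _ _ _ sf_prod
  sf_prod_sigma_finite.

End sigma_finite_product.

(** Lebesgue measure on [n.-tuple R], by recursion on [n]: the image of
    [sf_prod lebesgue_measure (lebesgue_tuple n)] under [(x, t) |-> x :: t]. *)

Section lebesgue_tuple.
Variable R : realType.
Local Notation T := (measurableTypeR R).

Definition tuple_cons n (x : T * n.-tuple T) : n.+1.-tuple T :=
  [tuple of x.1 :: x.2].

Lemma measurable_tuple_cons n : measurable_fun setT (@tuple_cons n).
Proof. exact: measurable_cons. Qed.

Section step.
Variables (n : nat) (m : {sigma_finite_measure set (n.-tuple T) -> \bar R}).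

Definition cons_measure : set (n.+1.-tuple T) -> \bar R :=
  pushforward (sf_prod lebesgue_measure m) (@tuple_cons n).

Let cons_measure0 : cons_measure set0 = 0%E.
Proof. by rewrite /cons_measure /pushforward preimage_set0 measure0. Qed.

Let cons_measure_ge0 A : (0 <= cons_measure A)%E.
Proof. by rewrite /cons_measure /pushforward. Qed.

Let cons_measure_sigma_additive : semi_sigma_additive cons_measure.
Proof.
move=> F mF tF mUF; rewrite /cons_measure /pushforward preimage_bigcup.
apply: measure_semi_sigma_additive.
- by move=> k; rewrite -[X in measurable X]setTI; exact: measurable_tuple_cons.
- apply/trivIsetP => /= i j _ _ ij; rewrite -preimage_setI.
  by move/trivIsetP : tF => /(_ _ _ _ _ ij) ->//; rewrite preimage_set0.
- rewrite -preimage_bigcup -[X in measurable X]setTI.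
  exact: measurable_tuple_cons.
Qed.

HB.instance Definition _ := isMeasure.Build _ _ _ cons_measure
  cons_measure0 cons_measure_ge0 cons_measure_sigma_additive.

Let cons_measure_sigma_finite : sigma_finite setT cons_measure.
Proof.
have /sigma_finiteP[F [TF ndF Foo]] :=
  sigma_finiteT (sf_prod lebesgue_measure m).
pose uncons (t : n.+1.-tuple T) := (thead t, [tuple of behead t]).
have consK : cancel (@tuple_cons n) uncons.
  by move=> [x t]; congr (_, _); apply: val_inj.
have muncons : measurable_fun setT uncons.
  by apply: measurable_fun_pair; [exact: measurable_tnth|
    exact: measurable_behead].
exists (fun k => uncons @^-1` F k).
  by rewrite -preimage_bigcup -TF preimage_setT.
move=> k; have [mFk Fkoo] := Foo k; split.
  by rewrite -[X in measurable X]setTI; exact: muncons.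
rewrite /cons_measure /pushforward -comp_preimage.
by rewrite (_ : uncons \o _ = id) //; apply/funext => x /=; rewrite consK.
Qed.

HB.instance Definition _ := Measure_isSigmaFinite.Build _ _ _ cons_measure
  cons_measure_sigma_finite.

End step.

Fixpoint lebesgue_tuple n :
    {sigma_finite_measure set (n.-tuple T) -> \bar R} :=
  match n with
  | 0 => \d_([tuple] : 0.-tuple T)
  | n.+1 => cons_measure (lebesgue_tuple n)
  end.

End lebesgue_tuple.

(** Complex-valued integration: measurability and integrals are taken
    componentwise on the real and imaginary parts. *)

Section complex_functions.
Context d (T : measurableType d) (R : realType).
Variable mu : {measure set T -> \bar R}.
Implicit Types (f : T -> R[i]) (p : \bar R).

Definition cintegral f : R[i] :=
  Complex (\int[mu]_x complex.Re (f x)) (\int[mu]_x complex.Im (f x)).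

Definition cLnorm p f : \bar R := 'N[mu]_p[(fun x => (normc (f x))%:E)]%E.

Definition cLfun p f : Prop :=
  [/\ measurable_fun setT (fun x => complex.Re (f x)),
      measurable_fun setT (fun x => complex.Im (f x)) &
      (cLnorm p f < +oo)%E].

End complex_functions.

Definition expi (R : realType) (t : R) : R[i] := Complex (cos t) (sin t).

(** Points [(p, q, t)] of the Heisenberg group, R^n x R^n x R. *)

Notation heis R n :=
  (n.-tuple (measurableTypeR R) * n.-tuple (measurableTypeR R) *
   measurableTypeR R)%type.

Section heisenberg.
Variables (R : realType) (n : nat).
Local Notation T := (measurableTypeR R).
Implicit Types p q : n.-tuple T.

Local Notation heis := (heis R n).

Definition tdot p q : R := \sum_(i < n) tnth p i * tnth q i.

Definition tadd p q : n.-tuple T := [tuple tnth p i + tnth q i | i < n].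

Definition heis_mul (X Y : heis) : heis :=
  let: (p, q, t) := X in let: (p', q', t') := Y in
  (tadd p p', tadd q q', t + t' + 2^-1 * (tdot p q' - tdot q p')).

Definition hdot (X Y : heis) : R :=
  let: (p, q, t) := X in let: (p', q', t') := Y in
  tdot p p' + tdot q q' + t * t'.

Definition hnorm (X : heis) : R := Num.sqrt (hdot X X).

Definition heis_measure : {sigma_finite_measure set heis -> \bar R} :=
  sf_prod (sf_prod (lebesgue_tuple R n) (lebesgue_tuple R n)) lebesgue_measure.

Local Notation mu := heis_measure.
Implicit Types f g h : heis -> R[i].

Definition fourier1 h (Q : heis) : R[i] :=
  cintegral mu (fun X => h X * expi (- (2 * pi * hdot Q X))).

(** The L^2 extension: [h] is (a representative of) the Fourier transform of
    [f] when [(f, h)] is an L^2 limit of pairs [(u, fourier1 u)] with [u] in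
    L^1 and L^2. *)

Definition is_fourier f h : Prop :=
  cLfun mu 2%:E h /\
  exists u : (heis -> R[i])^nat,
    [/\ forall k, cLfun mu 1%:E (u k) /\ cLfun mu 2%:E (u k),
        cLnorm mu 2%:E (fun X => u k X - f X) @[k --> \oo] --> 0%E &
        cLnorm mu 2%:E (fun Q => fourier1 (u k) Q - h Q) @[k --> \oo] --> 0%E].

Definition fourier f : heis -> R[i] := xget (fun=> 0) (is_fourier f).

(** The short-time Fourier transform [V_g f] is [stft g f]. *)

Definition stft g f (Q P : heis) : R[i] :=
  cintegral mu (fun X =>
    fourier f X * conjc (fourier g (heis_mul X P)) *
    expi (- (2 * pi * hdot Q X))).

End heisenberg.

(* Main.v *)
(* Plancherel in the variable X and the invariance of Lebesgue measure under
   Heisenberg translations give Moyal's identity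
   |V_g f|_2^2 = |F f|_2^2 |F g|_2^2, while Cauchy-Schwarz bounds |V_g f|^2
   pointwise by 2 |F f|_2^2 |F g|_2^2. Hence at most half of the mass of V_g f
   lies over the product of two balls of small radius r, and off that product
   one of |Q|^s, |P|^s exceeds r^s.

   Plancherel is proved on the line for real v in L^1 and L^2: damping the
   frequency integral by exp(- e |xi|) turns it into
   |v|_2^2 - 1/2 int P_e(z) |v(. + z) - v|_2^2 dz with P_e the Poisson kernel,
   and the error vanishes as e -> 0 because translations are continuous in
   L^2. Tonelli carries it to products, completeness of L^2 gives the Fourier
   transform on all of L^2. Constants do not matter, so |a + b|^2 <=
   2 |a|^2 + 2 |b|^2 replaces Minkowski's inequality throughout. *)

Require Import Defs.
From mathcomp Require Import all_boot all_order all_algebra.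
From mathcomp Require Import complex.
From mathcomp Require Import all_classical all_reals all_analysis.
From mathcomp Require Import measurable_realfun.
From mathcomp Require Import ring lra.

Set Implicit Arguments.
Unset Strict Implicit.
Unset Printing Implicit Defensive.

Import Order.TTheory GRing.Theory Num.Theory.
Import numFieldNormedType.Exports.
Import ComplexField.Normc.

Local Open Scope classical_set_scope.
Local Open Scope ring_scope.

(** * Lebesgue measure on the line *)

(** Two features of V_g f shape the proof. The transforms inside it are picked by a choice among L^2
    limits, so the estimates have to hold for whichever limit is picked: every one of them satisfies
    |f|_2^2 <= 4 |F f|_2^2, and Moyal's identity is then applied to the chosen functions as they
    are. Moreover V_g f is a plain integral at every Q and P, so F f(X) times the conjugate of F
    g(X.P) has to be integrable in X for every P; the inequality that shows this also gives the
    pointwise bound.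

    On the line, Fubini cannot be applied to the integral of |F v|^2, which is not known to be
    finite beforehand. With the damping, the triple integral over the frequency and two positions
    converges absolutely. On products, a slice of a function in L^1 and L^2 is again in L^1 and L^2
    only almost everywhere, so the one-factor identities are applied to almost every slice.

    The final constant is r^(2s) / 32: half of the mass survives outside the balls, and a factor 4
    is lost for each of f and g in passing to the transforms. *)

Section affine.
Variable R : realType.
Local Notation mu := (@lebesgue_measure R).
Local Notation T := (measurableTypeR R).

Lemma measurable_affine (a b : R) : measurable_fun setT (fun x : R => a * x + b).
Proof. by apply: measurable_funD => //; exact: measurable_funM. Qed.

(** The image of Lebesgue measure under the affine map, scaled by [a], has the right value on
    half-open intervals, and these determine Lebesgue measure. *)
Lemma lebesgue_measure_affine (a b : R) (A : set T) : 0 < a -> measurable A ->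
  mu A = (a%:E * mu ((fun x : T => (a * x + b)%R : T) @^-1` A))%E.
Proof.
move=> a0 mA.
pose phi (x : T) : T := a * x + b.
have mphi : measurable_fun setT phi by exact: measurable_affine.
unshelve epose (push := pushforward mu phi : {measure set T -> \bar R}).
  exact: mphi.
pose nu := mscale (NngNum (ltW a0)) push.
suff -> : mu A = nu A by [].
apply: lebesgue_measure_unique => // _ [[x y] /= xy] <-.
rewrite /nu /mscale/= /pushforward.
rewrite (_ : _ @^-1` _ = `](x - b) / a, (y - b) / a]%classic); last first.
  apply/seteqP; split => z /=; rewrite !in_itv/= ltr_pdivrMr// ler_pdivlMr//;
  by rewrite ltrBlDr lerBrDr mulrC.
rewrite !lebesgue_measure_itv/= !lte_fin.
rewrite ltr_pM2r ?invr_gt0// ltrD2r; case: ifPn => _; last by rewrite mule0.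
by rewrite -!EFinB -EFinM; congr EFin; field; rewrite gt_eqF.
Qed.

Lemma ge0_integral_affine (a b : R) (f : R -> \bar R) : 0 < a ->
  measurable_fun setT f -> (forall x, 0 <= f x)%E ->
  (\int[mu]_x f x = a%:E * \int[mu]_x f (a * x + b)%R)%E.
Proof.
move=> a0 mf f0.
pose phi (x : T) : T := a * x + b.
have mphi : measurable_fun setT phi by exact: measurable_affine.
unshelve epose (push := pushforward mu phi : {measure set T -> \bar R}).
  exact: mphi.
have -> : (\int[mu]_x f (a * x + b)%R = \int[push]_x f x)%E.
  by rewrite ge0_integral_pushforward// preimage_setT.
rewrite -[RHS](@ge0_integral_mscale _ _ _ _ setT measurableT (NngNum (ltW a0)))//.
by apply: eq_measure_integral => A mA _; exact: lebesgue_measure_affine.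
Qed.

Lemma ge0_integral_shift (b : R) (f : R -> \bar R) :
  measurable_fun setT f -> (forall x, 0 <= f x)%E ->
  (\int[mu]_x f (x + b)%R = \int[mu]_x f x)%E.
Proof.
move=> mf f0; rewrite [RHS](@ge0_integral_affine 1 b)// mul1e.
by apply: eq_integral => x _; rewrite mul1r.
Qed.

Lemma ge0_integral_opp (f : R -> \bar R) :
  measurable_fun setT f -> (forall x, 0 <= f x)%E ->
  (\int[mu]_x f (- x)%R = \int[mu]_x f x)%E.
Proof.
move=> mf f0.
have mphi : measurable_fun setT (-%R : T -> T) by exact: oppr_measurable.
unshelve epose (push := pushforward mu (-%R : T -> T) : {measure set T -> \bar R}).
  exact: mphi.
have -> : (\int[mu]_x f (- x)%R = \int[push]_x f x)%E.
  by rewrite ge0_integral_pushforward// preimage_setT.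
by apply: eq_measure_integral => A mA _; exact: lebesgue_measureN.
Qed.

End affine.

(** * Null sequences of nonnegative extended reals *)

Section ereal_cvg0.
Variable R : realType.
Implicit Types f : nat -> \bar R.

Lemma cvge0P f : (forall n, 0 <= f n)%E ->
  (forall e : R, 0 < e -> \forall n \near \oo, (f n <= e%:E)%E) ->
  f n @[n --> \oo] --> 0%E.
Proof.
move=> f0 fe; apply/fine_cvgP; split.
  have := fe 1 ltr01; apply: filterS => n fn.
  by rewrite ge0_fin_numE// (le_lt_trans fn)// ltry.
apply/cvgr0Pnorm_le => e e0; have := fe e e0; apply: filterS => n fn.
have fnfin : f n \is a fin_num.
  by rewrite ge0_fin_numE// (le_lt_trans fn)// ltry.
by rewrite /= ger0_norm ?fine_ge0// -lee_fin fineK.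
Qed.

Lemma cvge0_near f : f n @[n --> \oo] --> 0%E ->
  forall e : R, 0 < e -> \forall n \near \oo, (f n <= e%:E)%E.
Proof.
move=> /fine_cvgP[ffin /cvgr0Pnorm_le fe] e e0.
near=> n; have fnfin : f n \is a fin_num by near: n.
rewrite -(fineK fnfin) lee_fin (le_trans (ler_norm _))//.
by near: n; exact: fe.
Unshelve. all: end_near. Qed.

End ereal_cvg0.

(** * Continuity of translations in L^2 *)

Section translation.
Variable R : realType.
Local Notation mu := (@lebesgue_measure R).

Definition shift_defect (v : R -> R) (z : R) : \bar R :=
  (\int[mu]_y ((v (y + z)%R - v y) ^+ 2)%:E)%E.

Lemma measurable_shift (v : R -> R) z : measurable_fun setT v ->
  measurable_fun setT (fun y : R => v (y + z)).
Proof.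
move=> mv; apply: (measurableT_comp mv).
exact: measurable_funD.
Qed.

Lemma measurable_sqr_EFin d (T : measurableType d) (v : T -> R) :
  measurable_fun setT v ->
  measurable_fun setT (fun y => (v y ^+ 2)%:E).
Proof. by move=> mv; apply/measurable_EFinP; exact: measurable_funX. Qed.

(** Dominated convergence. The bound [Z] on the shifts keeps the supports of all translates inside
    one interval [D], on which [(2 M)^2] is a majorant. *)
Lemma shift_defect_bump (G : R -> R) (M N Z : R) (z : nat -> R) :
  continuous G -> (forall y, `|G y| <= M) -> (forall y, N < `|y| -> G y = 0) ->
  (forall n, `|z n| <= Z) -> z n @[n --> \oo] --> 0 ->
  shift_defect G (z n) @[n --> \oo] --> 0%E.
Proof.
move=> cG GM GN zZ z0.
have mG : measurable_fun setT G by exact: continuous_measurable_fun.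
have M0 : 0 <= M by exact: le_trans (normr_ge0 _) (GM 0).
pose D := `[(- (N + Z))%R, N + Z]%classic : set R.
pose g y := ((4 * M ^+ 2)%R%:E * (\1_D y)%:E)%E.
have := @dominated_convergence _ _ R mu setT measurableT
  (fun n y => ((G (y + z n) - G y) ^+ 2)%:E) (cst 0%E) g.
case.
- move=> n; apply: measurable_sqr_EFin.
  by apply: measurable_funB => //; exact: measurable_shift.
- exact: measurable_cst.
- apply: aeW => y _ /=; apply: cvg_EFin; first exact: nearW.
  rewrite -[X in _ --> X](_ : (G (y + 0) - G y) ^+ 2 = 0); last first.
    by rewrite addr0 subrr expr0n.
  apply: (@cvg_comp _ _ _ z (fun t => (G (y + t) - G y) ^+ 2) _ _ _ z0).
  apply: (@continuous_comp _ _ _ (fun t => G (y + t) - G y) (fun x => x ^+ 2));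
    last exact: exprn_continuous.
  apply: cvgB; last exact: cvg_cst.
  apply: (@continuous_comp _ _ _ (fun t => y + t) G); last exact: cG.
  by apply: cvgD; [exact: cvg_cst|exact: cvg_id].
- apply: integrableZl => //; exact: integrable_indic_itv.
- apply: aeW => y n _; rewrite gee0_abs ?lee_fin ?sqr_ge0//.
  rewrite /g indicE.
  have [yD|yD] := boolP (y \in D).
    rewrite mulr1 -real_normK ?num_real//.
    rewrite (_ : 4 * M ^+ 2 = (M + M) ^+ 2); last by ring.
    rewrite ler_sqr ?nnegrE ?addr_ge0//.
    by rewrite (le_trans (ler_normB _ _))// lerD.
  rewrite !GN ?subrr ?expr0n ?mulr0//.
    move: yD; rewrite notin_setE /D/= in_itv/= => /negP; rewrite -ler_norml -ltNge.
    by apply: le_lt_trans; rewrite lerDl (le_trans (normr_ge0 _) (zZ 0%N)).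
  move: yD; rewrite notin_setE /D/= in_itv/= => /negP; rewrite -ler_norml -ltNge.
  move=> NZy; have := lerB_normD y (z n); have := zZ n; lra.
- move=> _ _; rewrite integral0; exact.
Qed.

(** Splits [v (. + z) - v] into a translate of [v - w], the increment of [w], and [w - v]. The
    square of a sum of three terms costs a factor 3, and by translation invariance the two outer
    terms contribute equally, hence the 6. *)
Lemma le_shift_defect (v w : R -> R) z :
  measurable_fun setT v -> measurable_fun setT w ->
  (shift_defect v z <= 3%:E * shift_defect w z +
     6%:E * \int[mu]_y ((v y - w y) ^+ 2)%:E)%E.
Proof.
move=> mv mw.
have mvw : measurable_fun setT (fun y => v y - w y) by exact: measurable_funB.
set I := (\int[mu]_y _)%E.
have IE : (\int[mu]_y ((v (y + z)%R - w (y + z)%R) ^+ 2)%:E = I)%E.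
  apply: (@ge0_integral_shift R z (fun y => ((v y - w y) ^+ 2)%:E)).
  - exact: measurable_sqr_EFin.
  - by move=> y; rewrite lee_fin sqr_ge0.
have I0 : (0 <= I)%E by apply: integral_ge0 => y _; rewrite lee_fin sqr_ge0.
have -> : (6%:E * I = 3%:E * I + 3%:E * I)%E.
  by rewrite -ge0_muleDl// -EFinD; congr (_%:E * _)%E; ring.
rewrite -{1}IE /I.
have mdw : measurable_fun setT (fun y : R => w (y + z) - w y).
  by apply: measurable_funB => //; exact: measurable_shift.
have mdvw : measurable_fun setT (fun y : R => v (y + z) - w (y + z)).
  exact: (measurable_shift z mvw).
have mE (h : R -> R) : measurable_fun setT h ->
    measurable_fun setT (fun y => 3%:E * (h y ^+ 2)%:E)%E.
  by move=> mh; apply: measurable_funeM; exact: measurable_sqr_EFin.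
rewrite /shift_defect -!ge0_integralZl//; try exact: measurable_sqr_EFin;
  try by move=> y _; rewrite lee_fin sqr_ge0.
have E0 (x : R) : (0 <= 3%:E * (x ^+ 2)%:E :> \bar R)%E.
  by rewrite mule_ge0// lee_fin sqr_ge0.
rewrite -ge0_integralD//; try exact: mE.
rewrite -ge0_integralD//; try exact: mE; try by move=> y _; rewrite adde_ge0.
  2: by apply: emeasurable_funD; exact: mE.
apply: ge0_le_integral => //.
- by move=> y _; rewrite lee_fin sqr_ge0.
- apply: measurable_sqr_EFin; apply: measurable_funB => //.
  exact: measurable_shift.
- by apply: emeasurable_funD; [|apply: emeasurable_funD]; exact: mE.
move=> y _; rewrite -!EFinM -!EFinD lee_fin.
set a := v (y + z); set b := w (y + z).
have := sqr_ge0 ((a - b) - (b - w y)); have := sqr_ge0 ((a - b) + (v y - w y)).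
have := sqr_ge0 ((b - w y) + (v y - w y)).
nra.
Qed.

End translation.

(** * Density of compactly supported continuous functions in L^2 *)

Section translation_density.
Variable R : realType.
Local Notation mu := (@lebesgue_measure R).

(** Cutting both the argument and the value at [n] makes [trunc v n] a bounded function on a bounded
    interval, hence integrable. *)
Definition trunc_set (v : R -> R) (n : nat) : set R :=
  `[(- n%:R)%R, n%:R]%classic `&` v @^-1` `[(- n%:R)%R, n%:R]%classic.

Definition trunc (v : R -> R) n (y : R) := v y * \1_(trunc_set v n) y.

Lemma measurable_trunc_set (v : R -> R) n : measurable_fun setT v ->
  measurable (trunc_set v n).
Proof.
move=> mv; apply: measurableI; first exact: measurable_itv.
by rewrite -[X in measurable X]setTI; apply: mv => //; exact: measurable_itv.
Qed.

Lemma measurable_trunc (v : R -> R) n : measurable_fun setT v ->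
  measurable_fun setT (trunc v n).
Proof.
move=> mv; apply: measurable_funM => //.
by apply: measurable_indic; exact: measurable_trunc_set.
Qed.

Lemma trunc_cvg (v : R -> R) : measurable_fun setT v ->
  (\int[mu]_y (v y ^+ 2)%:E < +oo)%E ->
  (\int[mu]_y ((v y - trunc v n y) ^+ 2)%:E)%E @[n --> \oo] --> 0%E.
Proof.
move=> mv voo.
have [] // := @dominated_convergence _ _ R mu setT measurableT
  (fun n y => ((v y - trunc v n y) ^+ 2)%:E) (cst 0%E)
  (fun y => (v y ^+ 2)%:E).
- move=> n; apply: measurable_sqr_EFin.
  by apply: measurable_funB => //; exact: measurable_trunc.
- apply: aeW => y _ /=; apply: cvg_near_cst.
  near=> n; rewrite /trunc indicE mem_set ?mulr1 ?subrr ?expr0n//.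
  split; rewrite /= in_itv/= -ler_norml; near: n; exact: nbhs_infty_ger.
- apply/integrableP; split; first exact: measurable_sqr_EFin.
  by under eq_integral do rewrite gee0_abs ?lee_fin ?sqr_ge0//.
- apply: aeW => y n _; rewrite gee0_abs ?lee_fin ?sqr_ge0//.
  rewrite /trunc indicE; case: (y \in _).
    by rewrite mulr1 subrr expr0n/= sqr_ge0.
  by rewrite mulr0 subr0.
by move=> _ _; rewrite integral0.
Unshelve. all: end_near. Qed.

Definition cutoff (N y : R) : R := Num.max 0 (Num.min 1 (N + 1 - `|y|)).

Lemma cutoff_ge0 N y : 0 <= cutoff N y.
Proof. by rewrite /cutoff le_max lexx. Qed.

Lemma cutoff_le1 N y : cutoff N y <= 1.
Proof. by rewrite /cutoff ge_max ler01 ge_min lexx. Qed.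

Lemma cutoff1 N y : `|y| <= N -> cutoff N y = 1.
Proof.
move=> yN; rewrite /cutoff min_l; last by lra.
by rewrite max_r.
Qed.

Lemma cutoff0 N y : N + 1 < `|y| -> cutoff N y = 0.
Proof.
move=> yN; rewrite /cutoff max_l// ge_min; apply/orP; right; lra.
Qed.

Lemma continuous_cutoff N : continuous (cutoff N).
Proof.
move=> y.
apply: (@continuous_max _ _ (cst 0) (fun y => Num.min 1 (N + 1 - `|y|))).
  exact: cvg_cst.
apply: (@continuous_min _ _ (cst 1) (fun y => N + 1 - `|y|)).
  exact: cvg_cst.
apply: cvgB; first exact: cvg_cst.
exact: norm_continuous.
Qed.

Definition clip (M x : R) : R := Num.max (- M) (Num.min M x).

Lemma continuous_clip M : continuous (clip M).
Proof.
move=> y; apply: (@continuous_max _ _ (cst (- M)) (Num.min M)).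
  exact: cvg_cst.
by apply: (@continuous_min _ _ (cst M) id); [exact: cvg_cst|exact: cvg_id].
Qed.

Lemma clip_le M x : 0 <= M -> `|clip M x| <= M.
Proof.
move=> M0; rewrite ler_norml /clip le_max lexx/= ge_max ge_min lexx/= andbT.
lra.
Qed.

(** [clip M] is the nearest-point projection onto [[-M, M]], so it cannot move [y] away from a point
    of that interval. *)
Lemma clip_dist M x y : `|x| <= M -> `|x - clip M y| <= `|x - y|.
Proof.
rewrite ler_norml => /andP[Mx xM]; rewrite /clip maxEle minEle.
case: (lerP M y) => My; first by case: (lerP (- M) M) => HM;
  rewrite ler0_norm ?ler0_norm; lra.
case: (lerP (- M) y) => Hy //.
by rewrite ger0_norm ?ger0_norm; lra.
Qed.

(** Continuous functions approximate the truncation of [v] in L^1. Clipping and cutting off the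
    approximant bring it no further from the truncation, and between functions bounded by [M] the
    inequality |a - b|^2 <= 2 M |a - b| turns L^1 closeness into L^2 closeness. *)
Lemma bump_dense (v : R -> R) (e : R) : 0 < e -> measurable_fun setT v ->
  (\int[mu]_y (v y ^+ 2)%:E < +oo)%E ->
  exists G : R -> R, exists M N : R,
   [/\ continuous G, forall y, `|G y| <= M, forall y, N < `|y| -> G y = 0 &
       (\int[mu]_y ((v y - G y) ^+ 2)%:E <= e%:E)%E].
Proof.
move=> e0 mv voo.
have e40 : 0 < e / 4 by rewrite divr_gt0.
have [n _ /(_ n (leqnn n)) vn] := cvge0_near (trunc_cvg mv voo) e40.
(* The cutoff at [n] vanishes beyond [n + 1], so one number bounds both the support and the values;
   it is also positive when [n = 0]. *)
pose M : R := n%:R + 1; pose E := `[(- M)%R, M]%classic : set R.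
have M0 : 0 < M by rewrite ltr_wpDl.
have mE : measurable E by exact: measurable_itv.
have Efin : (mu E < +oo)%E.
  by rewrite /E lebesgue_measure_itv/=; case: ifPn => _; rewrite ?ltry.
have mt := measurable_trunc n mv.
have tM y : `|trunc v n y| <= M.
  rewrite /trunc indicE; have [|_] := boolP (y \in _); last first.
    by rewrite mulr0 normr0 ltW.
  rewrite inE => -[_]; rewrite /= in_itv/= -ler_norml mulr1 => /le_trans; apply.
  by rewrite lerDl.
have it : mu.-integrable E (EFin \o trunc v n).
  apply: measurable_bounded_integrable => //.
  - exact: measurable_funTS.
  - exists M; split; first exact: num_real.
    by move=> x Mx y _; apply: (le_trans (tM y)); exact: ltW.
have [g [cg ig]] := approximation_continuous_integrable mE Efin it.
(* Multiplied by the [2 * M] of the passage from L^1 to L^2 and by the 2 of |a + b|^2, this error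
   becomes [e / 2]; the truncation error [e / 4] supplies the other half. *)
have e8 : 0 < e / (8 * M) by rewrite divr_gt0// mulr_gt0.
move=> /cvge0_near /(_ _ e8)[k _ /(_ k (leqnn k)) gk].
pose G y := cutoff n%:R y * clip M (g k y).
have cG : continuous G.
  move=> y; apply: cvgM; first exact: continuous_cutoff.
  by apply: continuous_comp; [exact: cg|exact: continuous_clip].
have mG : measurable_fun setT G by exact: continuous_measurable_fun.
have GM y : `|G y| <= M.
  rewrite /G normrM ger0_norm ?cutoff_ge0//.
  by rewrite (le_trans _ (clip_le (g k y) (ltW M0)))// ler_piMl// cutoff_le1.
exists G, M, M; split => //.
  by move=> y My; rewrite /G cutoff0 ?mul0r.
(* The cutoff is 1 wherever the truncation is nonzero, so it factors out of the difference. *)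
have tG y : `|trunc v n y - G y| <= `|trunc v n y - g k y|.
  rewrite {1}(_ : trunc v n y = cutoff n%:R y * trunc v n y); last first.
    rewrite /trunc indicE; have [|_] := boolP (y \in _); last by rewrite !mulr0.
    rewrite inE => -[]; rewrite /= in_itv/= -ler_norml => yn _.
    by rewrite cutoff1// mul1r.
  rewrite /G -mulrBr normrM ger0_norm ?cutoff_ge0//.
  rewrite (le_trans (ler_piMl _ (cutoff_le1 _ _)))//.
  exact: clip_dist.
have mE0 (h : R -> R) : measurable_fun setT h ->
    measurable_fun setT (fun y => 2%:E * (h y ^+ 2)%:E)%E.
  by move=> mh; apply: measurable_funeM; exact: measurable_sqr_EFin.
have E0 (x : R) : (0 <= 2%:E * (x ^+ 2)%:E :> \bar R)%E.
  by rewrite mule_ge0// lee_fin sqr_ge0.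
have mvt : measurable_fun setT (fun y => v y - trunc v n y).
  exact: measurable_funB.
have mtG : measurable_fun setT (fun y => trunc v n y - G y).
  exact: measurable_funB.
apply: (@le_trans _ _ (\int[mu]_y (2%:E * ((v y - trunc v n y) ^+ 2)%:E +
                                   2%:E * ((trunc v n y - G y) ^+ 2)%:E))%E).
  apply: ge0_le_integral => //.
  - by move=> y _; rewrite lee_fin sqr_ge0.
  - by apply: measurable_sqr_EFin; exact: measurable_funB.
  - by apply: emeasurable_funD; exact: mE0.
  move=> y _; rewrite -!EFinM -!EFinD lee_fin.
  have := sqr_ge0 ((v y - trunc v n y) - (trunc v n y - G y)); nra.
rewrite ge0_integralD//; try exact: mE0.
rewrite !ge0_integralZl//; try exact: measurable_sqr_EFin;
  try by move=> y _; rewrite lee_fin sqr_ge0.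
have -> : e%:E = (2%:E * (e / 4)%:E + 2%:E * (2 * M * (e / (8 * M)))%:E)%E.
  by rewrite -!EFinM -EFinD; congr EFin; field; rewrite gt_eqF.
apply: leeD; first by rewrite lee_pmul2l// ?lte_fin.
rewrite lee_pmul2l//; apply: (@le_trans _ _
  (\int[mu]_(y in E) ((2 * M)%:E * `|(trunc v n y - g k y)%:E|))%E).
  rewrite [leRHS]integral_mkcond; apply: ge0_le_integral => //.
  - by move=> y _; rewrite lee_fin sqr_ge0.
  - exact: measurable_sqr_EFin.
  - apply/(measurable_restrictT _ _).1 => //.
    apply: measurable_funeM; apply/measurableT_comp => //; apply/measurable_EFinP.
    apply: measurable_funTS; apply: measurable_funB => //.
    exact: continuous_measurable_fun.
  move=> y _; rewrite patchE; case: ifPn => yE.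
    rewrite /= lee_fin -real_normK ?num_real// expr2 ler_pM//.
    by rewrite (le_trans (ler_normB _ _))// mulrDl mul1r lerD.
  have yM : M < `|y|.
    move: yE; rewrite notin_setE /E/= in_itv/= => /negP.
    by rewrite -ler_norml -ltNge.
  rewrite /G cutoff0// mul0r subr0 /trunc indicE memNset ?mulr0 ?expr0n//.
  move=> [+ _]; rewrite /= in_itv/= -ler_norml => yn.
  by move: yM; rewrite ltNge (le_trans yn)// lerDl.
rewrite ge0_integralZl//.
- by rewrite [leRHS]EFinM lee_pmul2l// lte_fin mulr_gt0.
- apply/measurableT_comp => //; apply/measurable_EFinP.
  apply: measurable_funTS; apply: measurable_funB => //.
  exact: continuous_measurable_fun.
- by rewrite lee_fin mulr_ge0// ltW.
Qed.

Lemma shift_defect_cvg (v : R -> R) (Z : R) (z : nat -> R) :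
  measurable_fun setT v -> (\int[mu]_y (v y ^+ 2)%:E < +oo)%E ->
  (forall n, `|z n| <= Z) -> z n @[n --> \oo] --> 0 ->
  shift_defect v (z n) @[n --> \oo] --> 0%E.
Proof.
move=> mv voo zZ z0; apply: cvge0P => [n|e e0].
  by apply: integral_ge0 => y _; rewrite lee_fin sqr_ge0.
(* The weights 6 and 3 of [le_shift_defect] turn the two errors into [e / 2] each. *)
have e12 : 0 < e / 12 by rewrite divr_gt0.
have e6 : 0 < e / 6 by rewrite divr_gt0.
have [G [M [N [cG GM GN vG]]]] := bump_dense e12 mv voo.
have := cvge0_near (shift_defect_bump cG GM GN zZ z0) e6.
apply: filterS => n Gn.
apply: (le_trans (le_shift_defect (z n) mv (continuous_measurable_fun cG))).
have -> : e%:E = (3%:E * (e / 6)%:E + 6%:E * (e / 12)%:E)%E.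
  by rewrite -!EFinM -EFinD; congr EFin; field.
by apply: leeD; rewrite lee_pmul2l// ?lte_fin.
Qed.

End translation_density.

(** * The Poisson kernel *)

Section laplace_cos.
Variable R : realType.
Local Notation mu := (@lebesgue_measure R).

(** The damping [exp (- e |x|)] folded onto the half-line; the factor 2 restores the whole line when
    it is integrated against an even function. *)
Definition expw (e x : R) : R := 2 * expR (- (e * x)) * \1_(`[0%R, +oo[%classic) x.

(* [1 + cos] rather than [cos]: the fundamental theorem of calculus on a
   half-line is available for nonnegative integrands. *)
Let f (e c x : R) : R := 2 * expR (- (e * x)) * (1 + cos (c * x)).

(** An antiderivative of [f e c] that vanishes at infinity: the cosine term is the real part of
    [exp ((- e + i c) x) / (- e + i c)], doubled. *)
Let F (e c x : R) : R :=
  expR (- (e * x)) *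
  (- (2 / e) + 2 * (c * sin (c * x) - e * cos (c * x)) / (e ^+ 2 + c ^+ 2)).

Let is_derive_F (e c x : R) : 0 < e -> is_derive x (1 : R) (F e c) (f e c x).
Proof.
move=> e0.
have De : is_derive x (1 : R) (fun x => expR (- (e * x)))
    (- e * expR (- (e * x))).
  have : is_derive x (1 : R) (fun x : R => - (e * x)) (- e).
    have : is_derive x (1 : R) (fun x : R => (- e) *: x) (- e *: 1).
      exact: is_deriveZ.
    rewrite /GRing.scale/= mulr1; congr is_derive.
    by apply/funext => y; rewrite mulNr.
  move=> h; rewrite mulrC.
  exact: (@is_derive1_comp _ expR (fun x : R => - (e * x)) x _ _ (is_derive_expR _) h).
have Dc : is_derive x (1 : R) (fun x : R => c * x) c.
  have : is_derive x (1 : R) (fun x : R => c *: x) (c *: 1).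
    exact: is_deriveZ.
  by rewrite /GRing.scale/= mulr1.
have Ds : is_derive x (1 : R) (fun x => sin (c * x)) (c * cos (c * x)).
  rewrite mulrC.
  exact: (@is_derive1_comp _ sin (fun x : R => c * x) x _ _ (is_derive_sin _) Dc).
have Dcos : is_derive x (1 : R) (fun x => cos (c * x)) (c * - sin (c * x)).
  rewrite mulrC.
  exact: (@is_derive1_comp _ cos (fun x : R => c * x) x _ _ (is_derive_cos _) Dc).
pose D := e ^+ 2 + c ^+ 2.
have D0 : D != 0 by rewrite gt_eqF// ltr_wpDr ?sqr_ge0// exprn_gt0.
have DG : is_derive x (1 : R)
  (fun x => - (2 / e) + ((2 * c / D) *: sin (c * x) - (2 * e / D) *: cos (c * x)))
  (0 + ((2 * c / D) *: (c * cos (c * x)) - (2 * e / D) *: (c * - sin (c * x)))).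
  exact: is_deriveD.
have DF := is_deriveM De DG.
rewrite (_ : F e c = (fun x => expR (- (e * x))) *
  (fun x => - (2 / e) + ((2 * c / D) *: sin (c * x) - (2 * e / D) *: cos (c * x)))).
  apply: is_derive_eq DF _.
  rewrite /GRing.scale/= /f -/D.
  rewrite [X in _ = X](_ : _ = expR (- (e * x)) * (2 + 2 / D * D * cos (c * x))).
    rewrite /D; field; rewrite -/D D0 gt_eqF//.
  by field; rewrite D0.
apply/funext => y; rewrite /F /= -/D; congr (_ * _).
by congr (_ + _); rewrite /GRing.scale/=; field.
Qed.

Let F_cvg0 e c : 0 < e -> F e c x @[x --> +oo] --> 0.
Proof.
move=> e0; set D := e ^+ 2 + c ^+ 2.
have D0 : 0 < D by rewrite ltr_wpDr ?sqr_ge0// exprn_gt0.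
pose K := 2 / e + 2 * (`|c| + e) / D.
have ecvg : K * expR (- (e * x)) @[x --> +oo] --> 0.
  rewrite -(mulr0 K); apply: cvgM; first exact: cvg_cst.
  apply: (@cvg_comp _ _ _ (fun x => e * x) (fun z => expR (- z)) _ (pinfty_nbhs R)).
    exact: gt0_cvgMry.
  exact: cvgr_expR.
apply/cvgr0Pnorm_le => d d0.
move/cvgr0Pnorm_le : ecvg => /(_ d d0); apply: filterS => x; apply: le_trans.
rewrite /F -/D normrM mulrC [leRHS]normrM.
rewrite ler_wpM2r// (le_trans (ler_normD _ _))// (le_trans _ (ler_norm _))//.
have e20 : 0 <= 2 / e by rewrite divr_ge0// ltW.
rewrite normrN /K (ger0_norm e20) lerD2l.
rewrite normrM normfV (ger0_norm (ltW D0)) ler_pM2r ?invr_gt0//.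
rewrite normrM (@ger0_norm _ 2)// ler_pM2l//.
rewrite (le_trans (ler_normB _ _))// lerD// normrM.
  by rewrite ler_piMr//; exact: sin_max.
by rewrite (ger0_norm (ltW e0)) ler_piMr ?(ltW e0)//; exact: cos_max.
Qed.

Let integral_f e c : 0 < e ->
  (\int[mu]_(x in `[0%R, +oo[) (f e c x)%:E =
   (2 / e + 2 * e / (e ^+ 2 + c ^+ 2))%:E)%E.
Proof.
move=> e0.
have D0 : 0 < e ^+ 2 + c ^+ 2 by rewrite ltr_wpDr ?sqr_ge0// exprn_gt0.
rewrite (ge0_continuous_FTC2y _ _ (F_cvg0 c e0)).
- rewrite -EFinB; congr EFin; rewrite /F !mulr0 oppr0 expR0 sin0 cos0; field.
  by rewrite !gt_eqF.
- move=> x _; have := cos_geN1 (c * x); rewrite /f => cN1.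
  by apply: mulr_ge0; [rewrite mulr_ge0// expR_ge0|lra].
- apply: continuous_subspaceT => x; rewrite /f; apply: cvgM.
    apply: cvgM; first exact: cvg_cst.
    apply: (@continuous_comp _ _ _ (fun x => - (e * x)) expR);
      last exact: continuous_expR.
    by apply: cvgN; apply: cvgM; [exact: cvg_cst|exact: cvg_id].
  apply: cvgD; first exact: cvg_cst.
  apply: (@continuous_comp _ _ _ (fun x => c * x) cos);
    last exact: continuous_cos.
  by apply: cvgM; [exact: cvg_cst|exact: cvg_id].
- by move=> x _; exact: (@ex_derive _ _ _ _ _ _ _ (is_derive_F c x e0)).
- apply: cvg_at_right_filter; apply: differentiable_continuous.
  apply/derivable1_diffP.
  exact: (@ex_derive _ _ _ _ _ _ _ (is_derive_F c 0 e0)).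
- move=> x _; rewrite derive1E.
  exact: (@derive_val _ _ _ _ _ _ _ (is_derive_F c x e0)).
Qed.

Lemma expw_ge0 e x : 0 <= expw e x.
Proof. by rewrite /expw !mulr_ge0// expR_ge0. Qed.

Lemma measurable_expw e : measurable_fun setT (expw e).
Proof.
apply: measurable_funM; last exact: measurable_indic.
apply: measurable_funM => //; apply: measurableT_comp => //.
by apply: measurableT_comp => //; exact: measurable_funM.
Qed.

Lemma integral_expw e : 0 < e -> (\int[mu]_x (expw e x)%:E = (2 / e)%:E)%E.
Proof.
move=> e0.
(* At [c = 0] the integrand [f] is twice [expw] on the half-line. *)
have := integral_f 0 e0.
rewrite (_ : (_ + _) = 2 * (2 / e)); last by rewrite expr0n/=; field; rewrite gt_eqF.
rewrite integral_mkcond.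
rewrite (_ : (fun _ => _) = (fun x => 2%:E * (expw e x)%:E)%E); last first.
  apply/funext => x; rewrite patchE /expw indicE; case: ifPn => _/=.
    by rewrite /f mul0r cos0 -EFinM; congr EFin; ring.
  by rewrite mulr0 mule0.
rewrite ge0_integralZl//.
- move=> /(congr1 (fun z => (2^-1)%:E * z)%E).
  rewrite muleA -!EFinM mulVf// mul1e => ->; congr EFin; field.
  by rewrite gt_eqF.
- by apply/measurable_EFinP; exact: measurable_expw.
- by move=> x _; rewrite lee_fin expw_ge0.
Qed.

Lemma integrable_expw e : 0 < e -> mu.-integrable setT (EFin \o expw e).
Proof.
move=> e0; apply/integrableP; split.
  by apply/measurable_EFinP; exact: measurable_expw.
under eq_integral do rewrite /= ger0_norm ?expw_ge0//.
by rewrite integral_expw// ltry.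
Qed.

(** The integral of [f] minus that of [expw], both finite. At [c = 2 pi z] the value is the Poisson
    kernel at [z]. *)
Lemma integral_expw_cos e c : 0 < e ->
  (\int[mu]_x (expw e x * cos (c * x))%:E =
   (2 * e / (e ^+ 2 + c ^+ 2))%:E)%E.
Proof.
move=> e0.
have mc : measurable_fun setT (fun x : R => cos (c * x)).
  apply: (measurableT_comp (continuous_measurable_fun (@continuous_cos R))).
  exact: measurable_funM.
have iec : mu.-integrable setT (fun x => (expw e x * cos (c * x))%:E).
  apply: (@le_integrable _ _ _ mu _ measurableT _ (EFin \o expw e)).
  - apply/measurable_EFinP; apply: measurable_funM => //.
    exact: measurable_expw.
  - move=> x _ /=; rewrite lee_fin normrM ler_piMr//.
    exact: cos_max.
  - exact: integrable_expw.
have := integral_f c e0; rewrite integral_mkcond.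
rewrite (_ : (fun _ => _) =
    (fun x => (expw e x)%:E + (expw e x * cos (c * x))%:E)%E); last first.
  apply/funext => x; rewrite patchE /expw indicE; case: ifPn => _/=.
    by rewrite /f -EFinD; congr EFin; ring.
  by rewrite !(mulr0, mul0r) adde0.
rewrite integralD//; last exact: integrable_expw.
rewrite integral_expw// -(fineK (integrable_fin_num _ iec))// -EFinD => -[].
by move=> /addrI ->.
Qed.

End laplace_cos.

(** * Measurability of integrals depending on a parameter *)

Section parametric_integral.
Context d1 d2 (T1 : measurableType d1) (T2 : measurableType d2) (R : realType).
Variable m2 : {sigma_finite_measure set T2 -> \bar R}.

(** By definition the integral is the difference of those of the positive and negative parts, and
    Tonelli's theorem applies to each. Slices on which [f] is not integrable are covered too. *)
Lemma measurable_integral_snd (f : T1 * T2 -> \bar R) :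
  measurable_fun setT f -> measurable_fun setT (fun x => \int[m2]_y f (x, y))%E.
Proof.
move=> mf; rewrite (_ : (fun x => _) = (fun x => \int[m2]_y (f^\+ (x, y)) -
    \int[m2]_y (f^\- (x, y)))%E).
  apply: emeasurable_funB; apply: measurable_fun_fubini_tonelli_F => //.
  - exact: measurable_funepos.
  - exact: measurable_funeneg.
apply/funext => x; rewrite [LHS]integralE.
under eq_integral do rewrite funepos_comp/=.
by under [X in (_ - X)%E = _]eq_integral do rewrite funeneg_comp/=.
Qed.

Lemma measurable_Rintegral_snd (f : T1 * T2 -> R) :
  measurable_fun setT f -> measurable_fun setT (fun x => \int[m2]_y f (x, y)).
Proof.
move=> mf; apply: measurableT_comp => //.
apply: (measurable_integral_snd (f := EFin \o f)).
exact/measurable_EFinP.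
Qed.

End parametric_integral.

(** * The Poisson kernel and its mass *)

Section real_plancherel.
Variable R : realType.
Local Notation mu := (@lebesgue_measure R).
Local Notation mu2 := (sf_prod mu mu).

(** The Fourier transform of [exp (- e |xi|)] with [2 pi] in the exponent; with this normalization
    its mass is 1. *)
Definition poisson (e z : R) : R := 2 * e / (e ^+ 2 + (2 * pi * z) ^+ 2).

Lemma poisson_ge0 e z : 0 < e -> 0 <= poisson e z.
Proof.
by move=> e0; rewrite divr_ge0 ?mulr_ge0 ?addr_ge0 ?sqr_ge0// ltW.
Qed.

Lemma poissonN e z : poisson e (- z) = poisson e z.
Proof. by rewrite /poisson mulrN sqrrN. Qed.

Lemma poisson_scale e z : 0 < e -> e * poisson e (e * z) = poisson 1 z.
Proof.
move=> e0; rewrite /poisson.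
rewrite (_ : (2 * pi * (e * z)) ^+ 2 = e ^+ 2 * (2 * pi * z) ^+ 2); last by ring.
have := sqr_ge0 (2 * pi * z); move: (_ ^+ 2) => q q0.
rewrite expr1n; field.
by rewrite !gt_eqF// ltr_wpDr// ?mulr_ge0// ?exprn_ge0 ?exprn_gt0// ltW.
Qed.

Lemma measurable_poisson e : 0 < e -> measurable_fun setT (poisson e).
Proof.
move=> e0; apply: continuous_measurable_fun => x; apply: cvgM.
  exact: cvg_cst.
apply: cvgV; first by rewrite gt_eqF// ltr_wpDr ?sqr_ge0// exprn_gt0.
apply: cvgD; first exact: cvg_cst.
apply: (@continuous_comp _ _ _ (fun z => 2 * pi * z) (fun z => z ^+ 2)).
  by apply: cvgM; [exact: cvg_cst|exact: cvg_id].
exact: exprn_continuous.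
Qed.

(** The substitution [t = 2 pi z] leads to the integral of [1 / (1 + t^2)], which is [pi]: twice its
    half-line value, by evenness. *)
Let integral_poisson1 : (\int[mu]_z (poisson 1 z)%:E = 1)%E.
Proof.
pose h (t : R) := (oneDsqr t)^-1.
have h0 t : 0 <= h t by rewrite invr_ge0.
have ch : continuous h by move=> t; exact: continuous_oneDsqrV.
have mh : measurable_fun setT (EFin \o h).
  by apply/measurable_EFinP; exact: continuous_measurable_fun.
have ih : (\int[mu]_t (h t)%:E = pi%:E)%E.
  rewrite ge0_symfun_integralT//; last by move=> t; rewrite /h/= /oneDsqr sqrrN.
  rewrite (_ : [set x | _] = `[0%R, +oo[%classic); last first.
    by apply/seteqP; split => x /=; rewrite in_itv/= andbT.
  by rewrite integral0y_oneDsqr -EFinM; congr EFin; field.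
have pi20 : 0 < 2 * pi :> R by rewrite mulr_gt0// pi_gt0.
rewrite (@ge0_integral_affine R (2 * pi) 0 (EFin \o h) pi20 mh) in ih; last first.
  by move=> x; rewrite lee_fin.
transitivity (\int[mu]_z (2%:E * (EFin \o h) (2 * pi * z + 0)%R))%E.
  apply: eq_integral => z _; rewrite /= -EFinM; congr EFin.
  by rewrite /poisson /h /oneDsqr addr0 expr1n mulr1.
rewrite ge0_integralZl//; last 2 first.
- by apply: (measurableT_comp mh); exact: measurable_affine.
- by move=> x _; rewrite lee_fin.
have := congr1 (fun z => (pi^-1)%:E * z)%E ih.
have pi0 : pi != 0 :> R by rewrite gt_eqF// pi_gt0.
rewrite muleA -!EFinM mulVf// => <-; congr (_%:E * _)%E.
by rewrite mulrCA mulVf// mulr1.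
Qed.

Lemma integral_poisson e : 0 < e -> (\int[mu]_z (poisson e z)%:E = 1)%E.
Proof.
move=> e0; rewrite (@ge0_integral_affine R e 0)//.
- rewrite -integral_poisson1 -ge0_integralZl//.
  + apply: eq_integral => z _.
    by rewrite addr0 -(poisson_scale z e0) EFinM.
  + apply/measurable_EFinP/(measurableT_comp (measurable_poisson e0)).
    exact: measurable_affine.
  + by move=> x _; rewrite lee_fin; exact: poisson_ge0.
  + by rewrite lee_fin ltW.
- by apply/measurable_EFinP; exact: measurable_poisson.
- by move=> x; rewrite lee_fin poisson_ge0.
Qed.

End real_plancherel.

(** * Plancherel for real functions on the line *)

Section sf_prod_fubini.
Context d1 d2 (T1 : measurableType d1) (T2 : measurableType d2) (R : realType).
Variable m1 : {sigma_finite_measure set T1 -> \bar R}.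
Variable m2 : {sigma_finite_measure set T2 -> \bar R}.
Variable f : T1 * T2 -> \bar R.
Hypothesis mf : measurable_fun setT f.

Lemma sf_tonelli1 : (forall x, 0 <= f x)%E ->
  (\int[sf_prod m1 m2]_z f z = \int[m1]_x \int[m2]_y f (x, y))%E.
Proof. exact: fubini_tonelli1. Qed.

Lemma sf_tonelli2 : (forall x, 0 <= f x)%E ->
  (\int[sf_prod m1 m2]_z f z = \int[m2]_y \int[m1]_x f (x, y))%E.
Proof. exact: fubini_tonelli2. Qed.

Lemma sf_integrable1P : (sf_prod m1 m2).-integrable setT f <->
  (\int[m1]_x \int[m2]_y `|f (x, y)| < +oo)%E.
Proof. exact: integrable12ltyP. Qed.

Lemma sf_fubini1 : (sf_prod m1 m2).-integrable setT f ->
  (\int[sf_prod m1 m2]_z f z = \int[m1]_x \int[m2]_y f (x, y))%E.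
Proof. by move=> fi; apply/esym; exact: integral12_prod_meas1. Qed.

Lemma sf_fubini2 : (sf_prod m1 m2).-integrable setT f ->
  (\int[sf_prod m1 m2]_z f z = \int[m2]_y \int[m1]_x f (x, y))%E.
Proof. by move=> fi; apply/esym; exact: integral21_prod_meas1. Qed.

End sf_prod_fubini.

Section tensor.
Context d1 d2 (T1 : measurableType d1) (T2 : measurableType d2) (R : realType).
Variable m1 : {sigma_finite_measure set T1 -> \bar R}.
Variable m2 : {sigma_finite_measure set T2 -> \bar R}.

Lemma integrable_tensor (f : T1 -> R) (g : T2 -> R) :
  m1.-integrable setT (EFin \o f) -> m2.-integrable setT (EFin \o g) ->
  (sf_prod m1 m2).-integrable setT (fun p => (f p.1 * g p.2)%:E).
Proof.
move=> /integrableP[mf fi] /integrableP[mg gi].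
move/measurable_EFinP in mf; move/measurable_EFinP in mg.
apply/sf_integrable1P.
  apply/measurable_EFinP; apply: measurable_funM; exact: measurableT_comp.
under eq_integral => x _.
  under eq_integral do rewrite /= normrM EFinM.
  rewrite ge0_integralZl//; last first.
    by apply/measurable_EFinP; exact: measurableT_comp.
  over.
rewrite ge0_integralZr//.
- rewrite lte_mul_pinfty//; first exact: integral_ge0.
  by rewrite ge0_fin_numE//; exact: integral_ge0.
- by apply/measurable_EFinP; exact: measurableT_comp.
- exact: integral_ge0.
Qed.

End tensor.

Lemma integrable_mul_le1 d (T : measurableType d) (R : realType)
    (mu : {measure set T -> \bar R}) (f h : T -> R) :
  mu.-integrable setT (EFin \o f) -> measurable_fun setT h ->
  (forall x, `|h x| <= 1) -> mu.-integrable setT (fun x => (f x * h x)%:E).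
Proof.
move=> fi mh h1; have /integrableP[/measurable_EFinP mf _] := fi.
apply: (@le_integrable _ _ _ mu _ measurableT _ (EFin \o f)) => //.
- by apply/measurable_EFinP; exact: measurable_funM.
- by move=> x _ /=; rewrite lee_fin normrM ler_piMr.
Qed.

Section real_plancherel.
Variable R : realType.
Local Notation mu := (@lebesgue_measure R).
Local Notation mu2 := (sf_prod mu mu).
Variable v : R -> R.
Hypothesis iv : mu.-integrable setT (EFin \o v).
Hypothesis v2 : (\int[mu]_x (v x ^+ 2)%:E < +oo)%E.

Let mv : measurable_fun setT v.
Proof. by move/integrableP : iv => [/measurable_EFinP]. Qed.

(** The Fourier transform of the real function [v] at [xi] is [cosft xi - i sinft xi]. *)
Definition cosft xi : R := \int[mu]_x (v x * cos (2 * pi * xi * x)).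
Definition sinft xi : R := \int[mu]_x (v x * sin (2 * pi * xi * x)).

Let measurable_cosM (c : R) : measurable_fun setT (fun x : R => cos (c * x)).
Proof.
apply: (measurableT_comp (continuous_measurable_fun (@continuous_cos R))).
exact: measurable_funM.
Qed.

Let measurable_sinM (c : R) : measurable_fun setT (fun x : R => sin (c * x)).
Proof.
apply: (measurableT_comp (continuous_measurable_fun (@continuous_sin R))).
exact: measurable_funM.
Qed.

Let integrable_vvM (h : R * R -> R) : measurable_fun setT h ->
  (forall x, `|h x| <= 1) ->
  mu2.-integrable setT (fun p => (v p.1 * v p.2 * h p)%:E).
Proof.
move=> mh h1; exact: (integrable_mul_le1 (integrable_tensor iv iv) mh h1).
Qed.

Let measurable_phase (xi : R) :
  measurable_fun setT (fun p : R * R => cos (2 * pi * (p.1 - p.2) * xi)).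
Proof.
apply: (measurableT_comp (continuous_measurable_fun (@continuous_cos R))).
apply: measurable_funM => //; apply: measurable_funM => //.
exact: measurable_funB.
Qed.

(** Each square is a double integral in [(x, y)], and [cos a cos b + sin a sin b = cos (a - b)]
    merges the two. *)
Lemma sqr_cosft_sinft xi : (cosft xi ^+ 2 + sinft xi ^+ 2)%:E =
  (\int[mu2]_p (v p.1 * v p.2 * cos (2 * pi * (p.1 - p.2) * xi))%:E)%E.
Proof.
have ic : mu.-integrable setT (fun x => (v x * cos (2 * pi * xi * x))%:E).
  apply: integrable_mul_le1 => // [|x]; [exact: measurable_cosM|exact: cos_max].
have is_ : mu.-integrable setT (fun x => (v x * sin (2 * pi * xi * x))%:E).
  apply: integrable_mul_le1 => // [|x]; [exact: measurable_sinM|exact: sin_max].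
have cE : (\int[mu]_x (v x * cos (2 * pi * xi * x))%:E = (cosft xi)%:E)%E.
  by rewrite fineK// integrable_fin_num.
have sE : (\int[mu]_x (v x * sin (2 * pi * xi * x))%:E = (sinft xi)%:E)%E.
  by rewrite fineK// integrable_fin_num.
have iZ (a : R) (f : R -> R) : mu.-integrable setT (EFin \o f) ->
    mu.-integrable setT (fun x => a%:E * (f x)%:E)%E.
  by move=> fi; exact: integrableZl.
have phaseE (a b x y : R) :
    a * cos (2 * pi * xi * x) * (b * cos (2 * pi * xi * y)) +
    a * sin (2 * pi * xi * x) * (b * sin (2 * pi * xi * y)) =
    a * b * cos (2 * pi * (x - y) * xi).
  rewrite (_ : 2 * pi * (x - y) * xi = 2 * pi * xi * x - 2 * pi * xi * y); last by ring.
  by rewrite cosB; ring.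
rewrite sf_fubini1; last first.
  by apply: integrable_vvM; [exact: measurable_phase|move=> p; exact: cos_max].
transitivity (\int[mu]_x ((cosft xi)%:E * (v x * cos (2 * pi * xi * x))%:E +
    (sinft xi)%:E * (v x * sin (2 * pi * xi * x))%:E))%E.
  rewrite integralD//; [|exact: iZ|exact: iZ].
  by rewrite !integralZl// cE sE -!EFinM -EFinD !expr2.
apply: eq_integral => x _.
transitivity (\int[mu]_y ((v x * cos (2 * pi * xi * x))%:E *
     (v y * cos (2 * pi * xi * y))%:E +
    (v x * sin (2 * pi * xi * x))%:E * (v y * sin (2 * pi * xi * y))%:E))%E.
  rewrite integralD//; [|exact: iZ|exact: iZ].
  by rewrite !integralZl// cE sE muleC; congr (_ + _)%E; rewrite muleC.
apply: eq_integral => y _ /=; rewrite -!EFinM -EFinD; congr EFin.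
exact: phaseE.
Qed.

(** Fubini in the frequency and the pair of positions: [expw e] times [v] times [v] is an integrable
    majorant. The frequency integral is then [integral_expw_cos] at [c = 2 pi (x - y)]. *)
Lemma integral_expw_sqft e : 0 < e ->
  (\int[mu]_xi (expw e xi * (cosft xi ^+ 2 + sinft xi ^+ 2))%:E =
   \int[mu2]_p (v p.1 * v p.2 * poisson e (p.1 - p.2))%:E)%E.
Proof.
move=> e0.
pose f (q : R * (R * R)) : \bar R :=
  (expw e q.1 * (v q.2.1 * v q.2.2 * cos (2 * pi * (q.2.1 - q.2.2) * q.1)))%:E.
have mvv : measurable_fun setT (fun p : R * R => v p.1 * v p.2).
  by apply: measurable_funM; exact: measurableT_comp.
have mcos : measurable_fun setT
    (fun q : R * (R * R) => cos (2 * pi * (q.2.1 - q.2.2) * q.1)).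
  apply: (measurableT_comp (continuous_measurable_fun (@continuous_cos R))).
  apply: measurable_funM => //; apply: measurable_funM => //.
  by apply: measurable_funB; exact: measurableT_comp.
have ivv : mu2.-integrable setT (EFin \o (fun p : R * R => v p.1 * v p.2)).
  exact: integrable_tensor.
have fi : (sf_prod mu mu2).-integrable setT f.
  apply: (@le_integrable _ _ _ (sf_prod mu mu2) _ measurableT _
    (fun q => (expw e q.1 * (v q.2.1 * v q.2.2))%:E)) => //.
  - apply/measurable_EFinP; apply: measurable_funM.
      by apply: measurableT_comp => //; exact: measurable_expw.
    apply: measurable_funM => //.
    exact: (measurableT_comp mvv measurable_snd).
  - move=> q _ /=; rewrite lee_fin !normrM ler_wpM2l// ler_piMr//.
    exact: cos_max.
  - exact: (integrable_tensor (m1 := mu) (m2 := mu2) (integrable_expw e0) ivv).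
transitivity (\int[mu]_xi \int[mu2]_p f (xi, p))%E.
  apply: eq_integral => xi _; rewrite EFinM sqr_cosft_sinft -integralZl//.
  apply: integrable_vvM; first exact: measurable_phase.
  by move=> p; exact: cos_max.
rewrite -sf_fubini1// sf_fubini2//; apply: eq_integral => p _.
transitivity (\int[mu]_xi ((v p.1 * v p.2)%:E *
    (expw e xi * cos (2 * pi * (p.1 - p.2) * xi))%:E))%E.
  by apply: eq_integral => xi _; rewrite /f/= -EFinM mulrCA.
rewrite integralZl//.
  by rewrite integral_expw_cos// -EFinM.
apply: (@le_integrable _ _ _ mu _ measurableT _ (EFin \o expw e)).
- apply/measurable_EFinP; apply: measurable_funM; last exact: measurable_cosM.
  exact: measurable_expw.
- by move=> x _ /=; rewrite lee_fin normrM ler_piMr//; exact: cos_max.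
- exact: integrable_expw.
Qed.

Let measurable_poissonB e : 0 < e ->
  measurable_fun setT (fun p : R * R => poisson e (p.1 - p.2)).
Proof.
by move=> e0; apply: (measurableT_comp (measurable_poisson e0));
  exact: measurable_funB.
Qed.

Let m2v1 : measurable_fun setT (fun p : R * R => v p.1).
Proof. exact: measurableT_comp. Qed.

Let m2v2 : measurable_fun setT (fun p : R * R => v p.2).
Proof. exact: measurableT_comp. Qed.

Let integral_poissonB e x : 0 < e ->
  (\int[mu]_y (poisson e (y - x))%:E = 1)%E.
Proof.
move=> e0; rewrite -(integral_poisson e0).
apply: (@ge0_integral_shift R (- x) (fun y => (poisson e y)%:E)).
- by apply/measurable_EFinP; exact: measurable_poisson.
- by move=> y; rewrite lee_fin poisson_ge0.
Qed.

Let integral_sqr_poisson1 e : 0 < e ->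
  (\int[mu2]_p (v p.1 ^+ 2 * poisson e (p.1 - p.2))%:E =
   \int[mu]_x (v x ^+ 2)%:E)%E.
Proof.
move=> e0; rewrite sf_tonelli1; last 2 first.
- apply/measurable_EFinP; apply: measurable_funM; last exact: measurable_poissonB.
  exact: measurable_funX.
- by move=> p; rewrite lee_fin mulr_ge0 ?sqr_ge0 ?poisson_ge0.
apply: eq_integral => x _ /=; under eq_integral do rewrite EFinM.
rewrite ge0_integralZl//.
- under eq_integral => y _.
    rewrite (_ : poisson e (x - y) = poisson e (y - x)).
      over.
    by rewrite -poissonN opprB.
  by rewrite integral_poissonB// mule1.
- apply/measurable_EFinP; apply: (measurableT_comp (measurable_poisson e0)).
  exact: measurable_funB.
- by move=> y _; rewrite lee_fin poisson_ge0.
- by rewrite lee_fin sqr_ge0.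
Qed.

Let integral_sqr_poisson2 e : 0 < e ->
  (\int[mu2]_p (v p.2 ^+ 2 * poisson e (p.1 - p.2))%:E =
   \int[mu]_x (v x ^+ 2)%:E)%E.
Proof.
move=> e0; rewrite sf_tonelli2; last 2 first.
- apply/measurable_EFinP; apply: measurable_funM; last exact: measurable_poissonB.
  exact: measurable_funX.
- by move=> p; rewrite lee_fin mulr_ge0 ?sqr_ge0 ?poisson_ge0.
apply: eq_integral => y _ /=; under eq_integral do rewrite EFinM.
rewrite ge0_integralZl//.
- by rewrite integral_poissonB// mule1.
- apply/measurable_EFinP; apply: (measurableT_comp (measurable_poisson e0)).
  exact: measurable_funB.
- by move=> x _; rewrite lee_fin poisson_ge0.
- by rewrite lee_fin sqr_ge0.
Qed.

(* [2 a b = a^2 + b^2 - (a - b)^2], and [poisson e] has mass 1. *)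
Lemma integral_poisson_defect e : 0 < e ->
  (\int[mu2]_p (v p.1 * v p.2 * poisson e (p.1 - p.2))%:E +
   (2^-1)%:E * \int[mu2]_p ((v p.1 - v p.2) ^+ 2 * poisson e (p.1 - p.2))%:E =
   \int[mu]_x (v x ^+ 2)%:E)%E.
Proof.
move=> e0.
have mP := measurable_poissonB e0.
have i1 : mu2.-integrable setT
    (fun p => (v p.1 ^+ 2 * poisson e (p.1 - p.2))%:E).
  apply/integrableP; split.
    apply/measurable_EFinP; apply: measurable_funM; last exact: mP.
    exact: measurable_funX.
  under eq_integral => p _.
    rewrite gee0_abs; last by rewrite lee_fin mulr_ge0 ?sqr_ge0 ?poisson_ge0.
    over.
  by rewrite integral_sqr_poisson1.
have i2 : mu2.-integrable setT
    (fun p => (v p.2 ^+ 2 * poisson e (p.1 - p.2))%:E).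
  apply/integrableP; split.
    apply/measurable_EFinP; apply: measurable_funM; last exact: mP.
    exact: measurable_funX.
  under eq_integral => p _.
    rewrite gee0_abs; last by rewrite lee_fin mulr_ge0 ?sqr_ge0 ?poisson_ge0.
    over.
  by rewrite integral_sqr_poisson2.
have i12 := integrableD measurableT i1 i2.
have id : mu2.-integrable setT
    (fun p => ((v p.1 - v p.2) ^+ 2 * poisson e (p.1 - p.2))%:E).
  apply: (@le_integrable _ _ _ mu2 _ measurableT _ _ _ _
    (integrableZl measurableT 2 i12)).
    apply/measurable_EFinP; apply: measurable_funM; last exact: mP.
    by apply: measurable_funX; exact: measurable_funB.
  move=> p _ /=; rewrite lee_fin; have := poisson_ge0 (p.1 - p.2) e0.
  move: (poisson _ _) => k k0; move: (v p.1) (v p.2) => a b.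
  have := sqr_ge0 (a - b); have := sqr_ge0 (a + b) => ab1 ab2.
  rewrite !ger0_norm; [nra|nra|nra].
have ix : mu2.-integrable setT
    (fun p => (v p.1 * v p.2 * poisson e (p.1 - p.2))%:E).
  apply: (@le_integrable _ _ _ mu2 _ measurableT _ _ _ _ i12).
    apply/measurable_EFinP; apply: measurable_funM; last exact: mP.
    exact: measurable_funM.
  move=> p _ /=; rewrite lee_fin; have := poisson_ge0 (p.1 - p.2) e0.
  move: (poisson _ _) => k k0; move: (v p.1) (v p.2) => a b.
  have := sqr_ge0 (a - b); have := sqr_ge0 (a + b) => ab1 ab2.
  rewrite normrM (ger0_norm k0) (@ger0_norm _ (_ + _)); last by nra.
  by rewrite -mulrDl ler_wpM2r// ler_norml; apply/andP; split; nra.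
rewrite -integralZl// -integralD//; last exact: integrableZl.
transitivity ((2^-1)%:E * \int[mu2]_p ((v p.1 ^+ 2 * poisson e (p.1 - p.2))%:E +
    (v p.2 ^+ 2 * poisson e (p.1 - p.2))%:E))%E.
  rewrite -integralZl//; apply: eq_integral => p _ /=.
  by rewrite -!EFinM -!EFinD; congr EFin; field.
rewrite integralD// integral_sqr_poisson1// integral_sqr_poisson2//.
move: v2; have : (0 <= \int[mu]_x (v x ^+ 2)%:E)%E.
  by apply: integral_ge0 => x _; rewrite lee_fin sqr_ge0.
by case: (integral _ _ _) => // r _ _; rewrite -EFinD -EFinM; congr EFin; field.
Qed.

(** After [x = y + z] the inner integral is a shift defect; the substitution [z = e w] then moves
    [e] from the kernel into the shift, so that the kernel stays fixed as [e] tends to 0. *)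
Lemma integral_defect e : 0 < e ->
  (\int[mu2]_p ((v p.1 - v p.2) ^+ 2 * poisson e (p.1 - p.2))%:E =
   \int[mu]_w ((poisson 1 w)%:E * shift_defect v (e * w)%R))%E.
Proof.
move=> e0; have mK := measurable_poisson e0.
pose h (q : R * R) : \bar R := ((v (q.2 + q.1) - v q.2) ^+ 2 * poisson e q.1)%:E.
have mvs : measurable_fun setT (fun q : R * R => v (q.2 + q.1)).
  by apply: measurableT_comp => //; exact: measurable_funD.
have mh : measurable_fun setT h.
  apply/measurable_EFinP; apply: measurable_funM.
    by apply: measurable_funX; exact: measurable_funB.
  exact: (measurableT_comp mK measurable_fst).
have h0 q : (0 <= h q)%E by rewrite lee_fin mulr_ge0 ?sqr_ge0 ?poisson_ge0.
have msd : measurable_fun setT (shift_defect v).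
  apply: (@measurable_integral_snd _ _ _ _ _ mu
    (fun q : R * R => ((v (q.2 + q.1) - v q.2) ^+ 2)%:E)).
  by apply: measurable_sqr_EFin; exact: measurable_funB.
have sd0 z : (0 <= shift_defect v z)%E.
  by apply: integral_ge0 => y _; rewrite lee_fin sqr_ge0.
transitivity (\int[mu]_z ((poisson e z)%:E * shift_defect v z))%E.
  rewrite sf_tonelli2; last 2 first.
  - apply/measurable_EFinP; apply: measurable_funM; last exact: measurable_poissonB.
    by apply: measurable_funX; exact: measurable_funB.
  - by move=> p; rewrite lee_fin mulr_ge0 ?sqr_ge0 ?poisson_ge0.
  transitivity (\int[mu]_y \int[mu]_z h (z, y))%E.
    apply: eq_integral => y _ /=.
    rewrite -(@ge0_integral_shift R y
      (fun x => ((v x - v y) ^+ 2 * poisson e (x - y))%:E)).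
    - by apply: eq_integral => z _; rewrite /h/= addrK (addrC y).
    - apply/measurable_EFinP; apply: measurable_funM.
        by apply: measurable_funX; exact: measurable_funB.
      by apply: (measurableT_comp mK); exact: measurable_funB.
    - by move=> x; rewrite lee_fin mulr_ge0 ?sqr_ge0 ?poisson_ge0.
  rewrite -sf_tonelli2// sf_tonelli1//; apply: eq_integral => z _.
  rewrite /h/=; under eq_integral do rewrite EFinM.
  rewrite ge0_integralZr//.
  - by rewrite muleC.
  - apply: measurable_sqr_EFin; apply: measurable_funB => //.
    exact: measurable_shift.
  - by move=> y _; rewrite lee_fin sqr_ge0.
  - by rewrite lee_fin poisson_ge0.
rewrite (@ge0_integral_affine R e 0)//; last 2 first.
- by apply: emeasurable_funM => //; exact/measurable_EFinP.
- by move=> z; rewrite mule_ge0// lee_fin poisson_ge0.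
rewrite -ge0_integralZl//.
- apply: eq_integral => w _; rewrite addr0 muleA -EFinM.
  by rewrite (poisson_scale w e0).
- apply: emeasurable_funM.
    apply/measurable_EFinP; apply: (measurableT_comp mK).
    exact: measurable_affine.
  by apply: (measurableT_comp msd); exact: measurable_affine.
- by move=> z _; rewrite mule_ge0// lee_fin poisson_ge0.
- by rewrite lee_fin ltW.
Qed.

End real_plancherel.

(** * Removing the damping *)

Section real_plancherel_limit.
Variable R : realType.
Local Notation mu := (@lebesgue_measure R).
Variable v : R -> R.
Hypothesis iv : mu.-integrable setT (EFin \o v).
Hypothesis v2 : (\int[mu]_x (v x ^+ 2)%:E < +oo)%E.

Let mv : measurable_fun setT v.
Proof. by move/integrableP : iv => [/measurable_EFinP]. Qed.

Lemma measurable_cosft : measurable_fun setT (cosft v).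
Proof.
apply: (@measurable_Rintegral_snd _ _ _ _ _ mu
  (fun p : R * R => v p.2 * cos (2 * pi * p.1 * p.2))).
apply: measurable_funM; first exact: measurableT_comp.
apply: (measurableT_comp (continuous_measurable_fun (@continuous_cos R))).
by apply: measurable_funM => //; exact: measurable_funM.
Qed.

Lemma measurable_sinft : measurable_fun setT (sinft v).
Proof.
apply: (@measurable_Rintegral_snd _ _ _ _ _ mu
  (fun p : R * R => v p.2 * sin (2 * pi * p.1 * p.2))).
apply: measurable_funM; first exact: measurableT_comp.
apply: (measurableT_comp (continuous_measurable_fun (@continuous_sin R))).
by apply: measurable_funM => //; exact: measurable_funM.
Qed.

Let v20 : (0 <= \int[mu]_x (v x ^+ 2)%:E)%E.
Proof. by apply: integral_ge0 => x _; rewrite lee_fin sqr_ge0. Qed.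

Let measurable_defect : measurable_fun setT (shift_defect v).
Proof.
apply: (@measurable_integral_snd _ _ _ _ _ mu
  (fun q : R * R => ((v (q.2 + q.1) - v q.2) ^+ 2)%:E)).
apply: measurable_sqr_EFin; apply: measurable_funB; last exact: measurableT_comp.
by apply: measurableT_comp => //; exact: measurable_funD.
Qed.

Let defect_ge0 z : (0 <= shift_defect v z)%E.
Proof. by apply: integral_ge0 => y _; rewrite lee_fin sqr_ge0. Qed.

(** [le_shift_defect] against the zero function. The bound is uniform in [z], so its product with
    [poisson 1] serves as a majorant. *)
Let le_defect z :
  (shift_defect v z <= 6%:E * \int[mu]_x (v x ^+ 2)%:E)%E.
Proof.
have := @le_shift_defect R v (cst 0) z mv (measurable_cst _).
rewrite (_ : shift_defect (cst 0) z = 0%E) ?mule0 ?add0e; last first.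
  by rewrite /shift_defect integral0_eq// => x _; rewrite /= subrr expr0n.
by under eq_integral do rewrite /= subr0.
Qed.

Lemma cvg_integral_defect (e : nat -> R) (E : R) :
  (forall n, 0 < e n <= E) -> e n @[n --> \oo] --> 0 ->
  (\int[mu]_w ((poisson 1 w)%:E * shift_defect v (e n * w)%R))%E
    @[n --> \oo] --> 0%E.
Proof.
move=> eE e0.
have mK := @measurable_poisson R 1 ltr01.
have ffin : (\int[mu]_x (v x ^+ 2)%:E)%E \is a fin_num by rewrite ge0_fin_numE.
have [] // := @dominated_convergence _ _ R mu setT measurableT
  (fun n w => (poisson 1 w)%:E * shift_defect v (e n * w)%R)%E (cst 0%E)
  (fun w => (6 * fine (\int[mu]_x (v x ^+ 2)%:E)%E)%:E * (poisson 1 w)%:E)%E.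
- move=> n; apply: emeasurable_funM; first exact/measurable_EFinP.
  apply: (measurableT_comp measurable_defect).
  exact: measurable_funM.
- apply: aeW => w _ /=; rewrite -(mule0 (poisson 1 w)%:E).
  apply: cvgeZl => //.
  apply: (@shift_defect_cvg R v (E * `|w|) (fun n => e n * w)) => //.
    move=> n; have /andP[en0 enE] := eE n.
    by rewrite normrM (ger0_norm (ltW en0)) ler_wpM2r.
  rewrite -(mul0r w); apply: cvgM => //; exact: cvg_cst.
- apply: integrableZl => //; apply/integrableP; split.
    exact/measurable_EFinP.
  under eq_integral => w _.
    rewrite gee0_abs; last by rewrite lee_fin poisson_ge0.
    over.
  by rewrite integral_poisson// ltry.
- apply: aeW => w n _; rewrite gee0_abs; last first.
    by rewrite mule_ge0// lee_fin poisson_ge0.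
  rewrite muleC lee_pmul ?lee_fin ?poisson_ge0//.
  by rewrite EFinM fineK.
by move=> _ _; rewrite integral0.
Qed.

(** The damped integral [J n] differs from the squared norm by half of [D n], which tends to 0. Its
    limit is also the undamped integral, by monotone convergence: finiteness of that integral is
    part of the conclusion, so no integrable majorant is at hand. *)
Lemma plancherel_real :
  (\int[mu]_xi (2 * \1_(`[0%R, +oo[%classic) xi *
      (cosft v xi ^+ 2 + sinft v xi ^+ 2))%:E =
   \int[mu]_x (v x ^+ 2)%:E)%E.
Proof.
set I := (\int[mu]_x (v x ^+ 2)%:E)%E.
have Ifin : I \is a fin_num by rewrite ge0_fin_numE.
pose e n : R := n.+1%:R^-1.
have e0 n : 0 < e n by rewrite invr_gt0.
pose S xi := cosft v xi ^+ 2 + sinft v xi ^+ 2.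
have S0 xi : 0 <= S xi by rewrite addr_ge0 ?sqr_ge0.
have mS : measurable_fun setT S.
  apply: measurable_funD; apply: measurable_funX.
  - exact: measurable_cosft.
  - exact: measurable_sinft.
pose D n := (\int[mu]_w ((poisson 1 w)%:E * shift_defect v (e n * w)%R))%E.
pose J n := (\int[mu]_xi (expw (e n) xi * S xi)%:E)%E.
have JD n : (J n + (2^-1)%:E * D n = I)%E.
  rewrite /J /D integral_expw_sqft// -integral_defect//.
  exact: integral_poisson_defect.
have D_cvg : D n @[n --> \oo] --> 0%E.
  apply: (@cvg_integral_defect e 1).
    by move=> n; rewrite e0/= invf_le1// ler1n.
  exact: cvg_harmonic.
have J_cvg : J n @[n --> \oo] --> I.
  rewrite (_ : J = (fun n => I - (2^-1)%:E * D n)%E).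
    rewrite -[X in _ --> X]sube0 -(mule0 (2^-1)%:E).
    apply: cvgeB; [by rewrite mule0 fin_num_adde_defl| exact: cvg_cst|].
    exact: cvgeZl.
  (* Subtraction requires [D n] to be finite; [JD] bounds it by the squared norm because [J n] is
     nonnegative. *)
  apply/funext => n; rewrite -(JD n) addeK//.
  have : ((2^-1)%:E * D n <= I)%E.
    rewrite -(JD n) leeDr// integral_ge0// => x _.
    by rewrite lee_fin mulr_ge0// expw_ge0.
  move=> /le_lt_trans/(_ v2) Dn; rewrite ge0_fin_numE//.
  rewrite mule_ge0// integral_ge0// => x _.
  by rewrite mule_ge0// lee_fin poisson_ge0.
apply: cvg_unique J_cvg => //.
rewrite (_ : (\int[mu]_xi _)%E =
    (\int[mu]_xi limn (fun n => (expw (e n) xi * S xi)%:E))%E); last first.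
  apply: eq_integral => xi _; apply/esym/cvg_lim => //; apply: cvg_EFin.
    exact: nearW.
  apply: cvgM; last exact: cvg_cst.
  apply: cvgM; last exact: cvg_cst.
  rewrite -[X in _ --> X]mulr1; apply: cvgM; first exact: cvg_cst.
  rewrite -(@expR0 R) -oppr0 -(mul0r xi).
  apply: continuous_cvg; first exact: continuous_expR.
  apply: cvgN; apply: cvgM; last exact: cvg_cst.
  exact: cvg_harmonic.
apply: cvg_monotone_convergence => //.
- move=> n; apply/measurable_EFinP; apply: measurable_funM => //.
  exact: measurable_expw.
- by move=> n x _; rewrite lee_fin mulr_ge0// expw_ge0.
- move=> x _ m n mn; rewrite lee_fin ler_wpM2r//.
  rewrite /expw indicE; have [|_] := boolP (x \in _); last by rewrite !mulr0.
  rewrite inE/= in_itv/= andbT => x0.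
  rewrite !mulr1 ler_wpM2l// ler_expR lerN2 ler_wpM2r// lef_pV2 ?posrE//.
  by rewrite ler_nat.
Qed.

End real_plancherel_limit.

Section plancherel_line.
Variable R : realType.
Local Notation mu := (@lebesgue_measure R).

(** One of the two copies of the half-line integral is reflected, and the indicators of the two
    half-lines add up to 1 almost everywhere. *)
Lemma ge0_integral_even (S : R -> R) : measurable_fun setT S ->
  (forall x, 0 <= S x) -> (forall x, S (- x) = S x) ->
  (\int[mu]_x (2 * \1_(`[0%R, +oo[%classic) x * S x)%:E =
   \int[mu]_x (S x)%:E)%E.
Proof.
move=> mS S0 SN; pose H : R -> R := \1_(`[0%R, +oo[%classic).
have mH : measurable_fun setT H by exact: measurable_indic.
have H0 x : 0 <= H x by [].
have mHS : measurable_fun setT (fun x => (H x * S x)%:E).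
  by apply/measurable_EFinP; exact: measurable_funM.
have mHSN : measurable_fun setT (fun x : R => (H (- x) * S x)%:E).
  apply/measurable_EFinP; apply: measurable_funM => //.
  exact: (measurableT_comp mH (@oppr_measurable R setT)).
transitivity (\int[mu]_x ((H x * S x)%:E + (H (- x)%R * S x)%:E))%E.
  rewrite ge0_integralD//; try by move=> x _; rewrite lee_fin mulr_ge0.
  rewrite -[in X in (_ + X)%E](@ge0_integral_opp R (fun x => (H (- x) * S x)%:E))//;
    last by move=> x; rewrite lee_fin mulr_ge0.
  under [in X in (_ + X)%E]eq_integral do rewrite opprK SN.
  rewrite -ge0_integralD//; try by move=> x _; rewrite lee_fin mulr_ge0.
  apply: eq_integral => x _; rewrite -EFinD; congr EFin.
  by rewrite -/(H x) -mulrA mulrDl mul1r.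
apply: ge0_ae_eq_integral => //.
- exact: emeasurable_funD.
- exact/measurable_EFinP.
- by move=> x _; rewrite -EFinD lee_fin addr_ge0// mulr_ge0.
- by move=> x _; rewrite lee_fin.
(* At 0 both indicators are 1, so the two integrands may differ there. *)
exists [set 0]; split; [exact: measurable_set1|exact: lebesgue_measure_set1|].
move=> x /= /not_implyP[_]; apply: contra_notP => x0.
rewrite -EFinD -mulrDl; congr EFin.
rewrite /H !indicE !mem_setE !in_itv/= !andbT oppr_ge0.
case: (ltgtP x 0) => [||//]; rewrite ?add0r ?addr0 ?mul1r//.
Qed.

(** For real [v] the function [cosft v] is even and [sinft v] is odd, so the sum of their squares is
    even. *)
Lemma plancherel_real_line (v : R -> R) :
  mu.-integrable setT (EFin \o v) -> (\int[mu]_x (v x ^+ 2)%:E < +oo)%E ->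
  (\int[mu]_xi (cosft v xi ^+ 2 + sinft v xi ^+ 2)%:E =
   \int[mu]_x (v x ^+ 2)%:E)%E.
Proof.
move=> iv v2; rewrite -plancherel_real// -ge0_integral_even//.
- apply: measurable_funD; apply: measurable_funX.
  + exact: measurable_cosft.
  + exact: measurable_sinft.
- by move=> x; rewrite addr_ge0 ?sqr_ge0.
- move=> x; congr (_ + _).
    by congr (_ ^+ 2); apply: eq_Rintegral => y _; rewrite mulrN mulNr cosN.
  rewrite -[RHS]sqrrN; congr (_ ^+ 2).
  rewrite /sinft /Rintegral -fineN -integralN.
    by congr fine; apply: eq_integral => y _; rewrite mulrN mulNr sinN mulrN EFinN.
  apply: integrable_add_def => //; apply: integrable_mul_le1 => // [|y].
    apply: (measurableT_comp (continuous_measurable_fun (@continuous_sin R))).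
    exact: measurable_funM.
  exact: sin_max.
Qed.

End plancherel_line.

(** * Complex-valued integration *)

Section complex_algebra.
Variable R : realType.
Implicit Types z w : R[i].

(** The squared modulus as a polynomial in the two components: identities become [ring] goals and no
    square root appears. *)
Definition sqn z : R := complex.Re z ^+ 2 + complex.Im z ^+ 2.

Lemma sqn_ge0 z : 0 <= sqn z.
Proof. by rewrite addr_ge0 ?sqr_ge0. Qed.

Lemma sqn_normc z : normc z ^+ 2 = sqn z.
Proof. by case: z => a b; rewrite /normc sqr_sqrtr// addr_ge0 ?sqr_ge0. Qed.

Lemma complex_ReM z w : complex.Re (z * w) =
  complex.Re z * complex.Re w - complex.Im z * complex.Im w.
Proof. by case: z; case: w. Qed.

Lemma complex_ImM z w : complex.Im (z * w) =
  complex.Re z * complex.Im w + complex.Im z * complex.Re w.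
Proof. by case: z; case: w. Qed.

Lemma complex_ReB z w : complex.Re (z - w) = complex.Re z - complex.Re w.
Proof. by case: z; case: w. Qed.

Lemma complex_ImB z w : complex.Im (z - w) = complex.Im z - complex.Im w.
Proof. by case: z; case: w. Qed.

Lemma sqnM z w : sqn (z * w) = sqn z * sqn w.
Proof. by rewrite /sqn complex_ReM complex_ImM; ring. Qed.

Lemma sqn_conj z : sqn (conjc z) = sqn z.
Proof. by case: z => a b; rewrite /sqn/= sqrrN. Qed.

Lemma sqn_expi t : sqn (expi t) = 1 :> R.
Proof. by rewrite /sqn/= cos2Dsin2. Qed.

Lemma sqnD_le z w : sqn (z + w) <= 2 * sqn z + 2 * sqn w.
Proof.
case: z w => a b [c d]; rewrite /sqn/=.
have := sqr_ge0 (a - c); have := sqr_ge0 (b - d); nra.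
Qed.

Lemma sqnN z : sqn (- z) = sqn z.
Proof. by case: z => a b; rewrite /sqn/= !sqrrN. Qed.

Lemma expiD (a b : R) : expi (a + b) = expi a * expi b.
Proof.
apply/eqP; rewrite eq_complex complex_ReM complex_ImM/= cosD sinD; apply/andP; split => //.
by rewrite addrC (mulrC (cos a)) (mulrC (sin b)).
Qed.

Lemma complexP z w : complex.Re z = complex.Re w -> complex.Im z = complex.Im w ->
  z = w.
Proof. by case: z => a b; case: w => c d /= -> ->. Qed.

End complex_algebra.

Section complex_measurable.
Context d (T : measurableType d) (R : realType).
Implicit Types f g : T -> R[i].

Definition cmeasurable f :=
  measurable_fun setT (fun x => complex.Re (f x)) /\
  measurable_fun setT (fun x => complex.Im (f x)).

Lemma cmeasurableM f g : cmeasurable f -> cmeasurable g ->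
  cmeasurable (fun x => f x * g x).
Proof.
move=> [f1 f2] [g1 g2]; split.
- under eq_fun do rewrite complex_ReM.
  by apply: measurable_funB; exact: measurable_funM.
- under eq_fun do rewrite complex_ImM.
  by apply: measurable_funD; exact: measurable_funM.
Qed.

Lemma cmeasurableB f g : cmeasurable f -> cmeasurable g ->
  cmeasurable (fun x => f x - g x).
Proof.
move=> [f1 f2] [g1 g2]; split.
- by under eq_fun do rewrite complex_ReB; exact: measurable_funB.
- by under eq_fun do rewrite complex_ImB; exact: measurable_funB.
Qed.

Lemma cmeasurable_conj f : cmeasurable f -> cmeasurable (fun x => conjc (f x)).
Proof.
move=> [f1 f2]; split.
- by rewrite (_ : (fun x => _) = (fun x => complex.Re (f x)))//;
    apply/funext => x; case: (f x).
- rewrite (_ : (fun x => _) = (fun x => - complex.Im (f x))).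
    exact: measurable_funN.
  by apply/funext => x; case: (f x).
Qed.

Lemma cmeasurable_expi (h : T -> R) : measurable_fun setT h ->
  cmeasurable (fun x => expi (h x)).
Proof.
move=> mh; split.
- exact: (measurableT_comp (continuous_measurable_fun (@continuous_cos R)) mh).
- exact: (measurableT_comp (continuous_measurable_fun (@continuous_sin R)) mh).
Qed.

Lemma measurable_sqn f : cmeasurable f ->
  measurable_fun setT (fun x => (sqn (f x))%:E).
Proof.
move=> [f1 f2]; apply/measurable_EFinP.
by apply: measurable_funD; exact: measurable_funX.
Qed.

End complex_measurable.

Lemma cmeasurable_comp d1 d2 (T1 : measurableType d1) (T2 : measurableType d2)
    (R : realType) (f : T2 -> R[i]) (h : T1 -> T2) :
  cmeasurable f -> measurable_fun setT h -> cmeasurable (fun x => f (h x)).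
Proof. 
by move=> [f1 f2] mh; split; [exact: (measurableT_comp f1 mh)|
  exact: (measurableT_comp f2 mh)].
Qed.

Section complex_integral.
Context d (T : measurableType d) (R : realType).
Variable mu : {measure set T -> \bar R}.
Implicit Types f g : T -> R[i].

Definition cintegrable f :=
  mu.-integrable setT (fun x => (complex.Re (f x))%:E) /\
  mu.-integrable setT (fun x => (complex.Im (f x))%:E).

Lemma cintegrable_measurable f : cintegrable f -> cmeasurable f.
Proof.
by move=> [/integrableP[/measurable_EFinP ? _] /integrableP[/measurable_EFinP ? _]].
Qed.

Lemma cintegrable_expi f (h : T -> R) : cintegrable f ->
  measurable_fun setT h -> cintegrable (fun x => f x * expi (h x)).
Proof.
move=> [f1 f2] mh; have [mc ms] := cmeasurable_expi mh.
have icos (u : T -> R) (ui : mu.-integrable setT (EFin \o u)) :=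
  integrable_mul_le1 ui mc (fun x => cos_max (h x)).
have isin (u : T -> R) (ui : mu.-integrable setT (EFin \o u)) :=
  integrable_mul_le1 ui ms (fun x => sin_max (h x)).
split.
- under eq_fun do rewrite complex_ReM EFinB.
  exact: (integrableB measurableT (icos _ f1) (isin _ f2)).
- under eq_fun do rewrite complex_ImM EFinD.
  exact: (integrableD measurableT (isin _ f1) (icos _ f2)).
Qed.

Lemma cintegralZr f (c : R[i]) : cintegrable f ->
  cintegral mu (fun x => f x * c) = cintegral mu f * c.
Proof.
move=> [f1 f2]; have iZ (g : T -> R) (a : R) : mu.-integrable setT (EFin \o g) ->
    mu.-integrable setT (EFin \o (fun x => g x * a)).
  by move=> gi; under [X in integrable _ _ X]eq_fun do rewrite /= EFinM;
    exact: integrableZr.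
apply: complexP; rewrite ?complex_ReM ?complex_ImM /cintegral /=.
- under eq_Rintegral do rewrite complex_ReM.
  by rewrite RintegralB//; [rewrite !RintegralZr|exact: iZ|exact: iZ].
- under eq_Rintegral do rewrite complex_ImM.
  by rewrite RintegralD//; [rewrite !RintegralZr|exact: iZ|exact: iZ].
Qed.

Lemma ae_eq_cintegral f g : cmeasurable f -> cmeasurable g ->
  {ae mu, forall x, f x = g x} -> cintegral mu f = cintegral mu g.
Proof.
move=> [f1 f2] [g1 g2] fg; apply: complexP; congr fine;
  apply: ae_eq_integral => //; try exact/measurable_EFinP;
  by apply: filterS fg => x -> _.
Qed.

End complex_integral.

(** * Fubini's theorem for complex functions *)

Section complex_fubini.
Context d1 d2 (T1 : measurableType d1) (T2 : measurableType d2) (R : realType).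
Variable m1 : {sigma_finite_measure set T1 -> \bar R}.
Variable m2 : {sigma_finite_measure set T2 -> \bar R}.

Lemma cmeasurable_cintegral_snd (f : T1 * T2 -> R[i]) : cmeasurable f ->
  cmeasurable (fun x => cintegral m2 (fun y => f (x, y))).
Proof.
move=> [f1 f2]; split.
- exact: (measurable_Rintegral_snd m2 f1).
- exact: (measurable_Rintegral_snd m2 f2).
Qed.

(** The inner integral is finite for almost every [y], and there the real-valued integral agrees
    with the extended one. *)
Let Rfubini (f : T1 * T2 -> R) :
  (sf_prod m1 m2).-integrable setT (EFin \o f) ->
  m2.-integrable setT (fun y => (\int[m1]_x f (x, y))%:E) /\
  \int[sf_prod m1 m2]_p f p = \int[m2]_y \int[m1]_x f (x, y).
Proof.
move=> fi.
have Gi : m2.-integrable setT (fun y => \int[m1]_x (f (x, y))%:E)%E.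
  have mf := measurable_int _ fi.
  have mG : measurable_fun setT (fun y => \int[m1]_x (f (x, y))%:E)%E.
    exact: (@measurable_fubini_G _ _ _ _ _ m1 m2 _ fi).
  apply/integrableP; split=> //.
  apply: le_lt_trans ((@integrable21ltyP _ _ _ _ _ m1 m2 _ mf).1 fi).
  apply: ge0_le_integral => //.
  - exact: measurableT_comp.
  - apply: (@measurable_fun_fubini_tonelli_G _ _ _ _ _ m1 (fun p => `|(f p)%:E|)%E) => //.
    exact: measurableT_comp.
  - move=> y _; apply: le_abse_integral => //.
    exact: (measurableT_comp mf).
have mG := measurable_int _ Gi.
have mfG : measurable_fun setT (fun y => \int[m1]_x f (x, y)).
  exact: (measurableT_comp _ mG).
split.
  apply: (le_integrable _ _ _ Gi) => //; first exact/measurable_EFinP.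
  (* [fine] sends an infinite inner integral to 0, which only lowers its absolute value. *)
  move=> y _ /=; rewrite /Rintegral; case: (integral _ _ _) => [r| |]//=;
  by rewrite normr0 leey.
congr fine; rewrite sf_fubini2//; apply: ae_eq_integral => //.
  exact/measurable_EFinP.
have := integrable_ae measurableT Gi.
by apply: filterS => y /(_ I) yfin _; rewrite /= fineK.
Qed.

Lemma cfubini (f : T1 * T2 -> R[i]) : cintegrable (sf_prod m1 m2) f ->
  cintegrable m2 (fun y => cintegral m1 (fun x => f (x, y))) /\
  cintegral (sf_prod m1 m2) f =
  cintegral m2 (fun y => cintegral m1 (fun x => f (x, y))).
Proof.
move=> [f1 f2]; have [i1 e1] := Rfubini f1; have [i2 e2] := Rfubini f2.
by split; [split|rewrite /cintegral e1 e2].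
Qed.

Lemma ae_cintegrable2 (f : T1 * T2 -> R[i]) : cintegrable (sf_prod m1 m2) f ->
  {ae m2, forall y, cintegrable m1 (fun x => f (x, y))}.
Proof.
move=> [f1 f2].
have h1 := @ae_integrable2 _ _ _ _ _ m1 m2 _ f1.
have h2 := @ae_integrable2 _ _ _ _ _ m1 m2 _ f2.
by apply: filterS2 h1 h2 => y ? ?; split.
Qed.

End complex_fubini.

Lemma ae_integral_lty d (T : measurableType d) (R : realType)
    (mu : {measure set T -> \bar R}) (f : T -> \bar R) :
  measurable_fun setT f -> (forall x, 0 <= f x)%E -> (\int[mu]_x f x < +oo)%E ->
  {ae mu, forall x, (f x < +oo)%E}.
Proof.
move=> mf f0 foo.
have fi : mu.-integrable setT f.
  by apply/integrableP; split=> //; under eq_integral do rewrite gee0_abs//.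
have := integrable_ae measurableT fi.
by apply: filterS => x /(_ I); rewrite ge0_fin_numE.
Qed.

(** * Plancherel on products *)

Lemma measurable_fun2 d d1 d2 d3 (S : measurableType d) (T1 : measurableType d1)
    (T2 : measurableType d2) (T3 : measurableType d3) (B : T1 -> T2 -> T3)
    (f : S -> T1) (g : S -> T2) :
  measurable_fun setT (fun p : T1 * T2 => B p.1 p.2) ->
  measurable_fun setT f -> measurable_fun setT g ->
  measurable_fun setT (fun s => B (f s) (g s)).
Proof.
by move=> mB mf mg; exact: (measurableT_comp mB (measurable_fun_pair mf mg)).
Qed.

Section fourier_kernel.
Context d (T : measurableType d) (R : realType).
Variable mu : {sigma_finite_measure set T -> \bar R}.
Variable B : T -> T -> R.

(** [fourier1] with the measure and the pairing left abstract. *)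
Definition ft (u : T -> R[i]) (q : T) : R[i] :=
  cintegral mu (fun x => u x * expi (- (2 * pi * B q x))).

(** Abstract in the pairing, so that the identity passes through products and changes of variables.
    Measurability of [B] is bundled because each such passage uses it. *)
Definition plancherel := measurable_fun setT (fun p : T * T => B p.1 p.2) /\
  forall u, cintegrable mu u -> (\int[mu]_x (sqn (u x))%:E < +oo)%E ->
    (\int[mu]_q (sqn (ft u q))%:E = \int[mu]_x (sqn (u x))%:E)%E.

Hypothesis mB : measurable_fun setT (fun p : T * T => B p.1 p.2).

Lemma measurable_phase2 :
  measurable_fun setT (fun p : T * T => - (2 * pi * B p.1 p.2)).
Proof. by apply: measurable_funN; exact: measurable_funM. Qed.

Lemma measurable_phase1 q :
  measurable_fun setT (fun x : T => - (2 * pi * B q x)).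
Proof. exact: (measurableT_comp measurable_phase2 (pair1_measurable q)). Qed.

Lemma cmeasurable_ft u : cmeasurable u -> cmeasurable (ft u).
Proof.
move=> mu_; apply: (@cmeasurable_cintegral_snd _ _ _ _ _ mu
  (fun p : T * T => u p.2 * expi (- (2 * pi * B p.1 p.2)))).
apply: cmeasurableM; first exact: cmeasurable_comp.
exact: cmeasurable_expi measurable_phase2.
Qed.

Lemma cintegrable_ft u q : cintegrable mu u ->
  cintegrable mu (fun x => u x * expi (- (2 * pi * B q x))).
Proof. by move=> ui; apply: cintegrable_expi => //; exact: measurable_phase1. Qed.

End fourier_kernel.

Section plancherel_prod.
Context d1 d2 (T1 : measurableType d1) (T2 : measurableType d2) (R : realType).
Variable m1 : {sigma_finite_measure set T1 -> \bar R}.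
Variable m2 : {sigma_finite_measure set T2 -> \bar R}.
Variables (B1 : T1 -> T1 -> R) (B2 : T2 -> T2 -> R).

Definition sum_pairing (q x : T1 * T2) : R := B1 q.1 x.1 + B2 q.2 x.2.

(** Transforms one variable at a time, through the partial transform [w]. For almost every [x2] the
    slice of [u] is in L^1 and L^2, so the first identity gives [w] the energy of [u]. For the
    second variable, [w (q1, .)] is in L^1 for every [q1] by Fubini and in L^2 for almost every [q1]
    by the energy just found. *)
Lemma plancherel_prod : plancherel m1 B1 -> plancherel m2 B2 ->
  plancherel (sf_prod m1 m2) sum_pairing.
Proof.
move=> [mB1 PL1] [mB2 PL2].
have mB : measurable_fun setT
    (fun p : (T1 * T2) * (T1 * T2) => sum_pairing p.1 p.2).
  apply: measurable_funD.
  - by apply: (measurable_fun2 mB1); exact: measurableT_comp.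
  - by apply: (measurable_fun2 mB2); exact: measurableT_comp.
split=> // u ui u2; have mu_ := cintegrable_measurable ui.
pose w (p : T1 * T2) := ft m1 B1 (fun x => u (x, p.2)) p.1.
have mw : cmeasurable w.
  apply: (@cmeasurable_cintegral_snd _ _ _ _ _ m1
    (fun p : (T1 * T2) * T1 => u (p.2, p.1.2) *
       expi (- (2 * pi * B1 p.1.1 p.2)))).
  apply: cmeasurableM.
    apply: cmeasurable_comp => //; apply: measurable_fun_pair => //.
    exact: measurableT_comp.
  apply: (cmeasurable_expi (h := fun p : (T1 * T2) * T1 =>
    - (2 * pi * B1 p.1.1 p.2))).
  apply: measurable_funN; apply: measurable_funM => //.
  by apply: (measurable_fun2 mB1) => //; exact: measurableT_comp.
pose e1 q1 (p : T1 * T2) := expi (- (2 * pi * B1 q1 p.1)) : R[i].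
have me1 q1 : measurable_fun setT (fun p : T1 * T2 => - (2 * pi * B1 q1 p.1)).
  exact: (measurableT_comp (measurable_phase1 mB1 q1) measurable_fst).
have iw q1 : cintegrable m2 (fun x2 => w (q1, x2)).
  exact: (cfubini (cintegrable_expi ui (me1 q1))).1.
have ftE q1 q2 : ft (sf_prod m1 m2) sum_pairing u (q1, q2) =
    ft m2 B2 (fun x2 => w (q1, x2)) q2.
  have [i e] := cfubini (cintegrable_ft mB (q1, q2) ui).
  (* Only almost everywhere: the inner integral is a junk value where the slice
     of [u] is not integrable. *)
  rewrite /ft e; apply: ae_eq_cintegral.
  - exact: cintegrable_measurable i.
  - exact: cintegrable_measurable (cintegrable_ft mB2 q2 (iw q1)).
  have := ae_cintegrable2 (cintegrable_expi ui (me1 q1)).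
  apply: filterS => x2 ix2; rewrite /w /ft -cintegralZr//; congr cintegral.
  apply/funext => x1; rewrite /sum_pairing/= mulrDr opprD expiD.
  by rewrite mulrA.
have msw := measurable_sqn mw.
have msu := measurable_sqn mu_.
have wE : (\int[m1]_q1 \int[m2]_x2 (sqn (w (q1, x2)))%:E =
           \int[sf_prod m1 m2]_p (sqn (u p))%:E)%E.
  rewrite -(sf_tonelli1 m1 m2 msw) ?(sf_tonelli2 m1 m2 msw) ?(sf_tonelli2 m1 m2 msu);
    try by move=> p; rewrite lee_fin sqn_ge0.
  have mI (g : T1 * T2 -> \bar R) : measurable_fun setT g ->
      measurable_fun setT (fun y => \int[m1]_x g (x, y))%E.
    move=> mg; apply: (@measurable_integral_snd _ _ _ _ _ m1
      (fun p : T2 * T1 => g (p.2, p.1))).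
    by apply: measurableT_comp => //; exact: measurable_fun_pair.
  apply: ae_eq_integral => //; [exact: (mI _ msw)|exact: (mI _ msu)|].
  have u2' : (\int[m2]_y \int[m1]_x (sqn (u (x, y)))%:E < +oo)%E.
    by rewrite -(sf_tonelli2 m1 m2 msu)//; move=> p; rewrite lee_fin sqn_ge0.
  have u20 y : (0 <= \int[m1]_x (sqn (u (x, y)))%:E)%E.
    by apply: integral_ge0 => x _; rewrite lee_fin sqn_ge0.
  have := ae_integral_lty (mI _ msu) u20 u2'.
  have := ae_cintegrable2 ui; apply: filterS2 => y iy uy _.
  exact: (PL1 _ iy uy).
have mI (g : T1 * T2 -> \bar R) : measurable_fun setT g ->
    measurable_fun setT (fun x => \int[m2]_y g (x, y))%E.
  by move=> mg; exact: measurable_integral_snd.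
have msf := measurable_sqn (cmeasurable_ft (sf_prod m1 m2) mB mu_).
rewrite -wE (sf_tonelli1 m1 m2 msf); last by move=> p; rewrite lee_fin sqn_ge0.
apply: ae_eq_integral => //; [exact: (mI _ msf)|exact: (mI _ msw)|].
have w20 q : (0 <= \int[m2]_x (sqn (w (q, x)))%:E)%E.
  by apply: integral_ge0 => x _; rewrite lee_fin sqn_ge0.
(* Finite total energy makes almost every slice of [w] square integrable. *)
have w2 : (\int[m1]_q \int[m2]_x (sqn (w (q, x)))%:E < +oo)%E by rewrite wE.
have := ae_integral_lty (mI _ msw) w20 w2; apply: filterS => q1 wq1 _.
by under eq_integral do rewrite ftE; exact: PL2.
Qed.

End plancherel_prod.

Lemma plancherel_line (R : realType) :
  plancherel (@lebesgue_measure R) (fun q x : R => q * x).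
Proof.
have mB : measurable_fun setT (fun p : R * R => p.1 * p.2).
  exact: measurable_funM.
split=> // u ui u2; have [mu1 mu2] := cintegrable_measurable ui.
have [i1 i2] := ui.
pose u1 x := complex.Re (u x); pose u2' x := complex.Im (u x).
have le1 : (\int[lebesgue_measure]_x (u1 x ^+ 2)%:E < +oo)%E.
  apply: le_lt_trans u2; apply: ge0_le_integral => //.
  - by move=> x _; rewrite lee_fin sqr_ge0.
  - exact: measurable_sqr_EFin.
  - by apply: measurable_sqn.
  - by move=> x _; rewrite lee_fin lerDl sqr_ge0.
have le2 : (\int[lebesgue_measure]_x (u2' x ^+ 2)%:E < +oo)%E.
  apply: le_lt_trans u2; apply: ge0_le_integral => //.
  - by move=> x _; rewrite lee_fin sqr_ge0.
  - exact: measurable_sqr_EFin.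
  - by apply: measurable_sqn.
  - by move=> x _; rewrite lee_fin lerDr sqr_ge0.
have mcosM (c : R) : measurable_fun setT (fun x : R => cos (c * x)).
  apply: (measurableT_comp (continuous_measurable_fun (@continuous_cos R))).
  exact: measurable_funM.
have msinM (c : R) : measurable_fun setT (fun x : R => sin (c * x)).
  apply: (measurableT_comp (continuous_measurable_fun (@continuous_sin R))).
  exact: measurable_funM.
have icos (v : R -> R) c (vi : lebesgue_measure.-integrable setT (EFin \o v)) :=
  integrable_mul_le1 vi (mcosM c) (fun x => cos_max (c * x)).
have isin (v : R -> R) c (vi : lebesgue_measure.-integrable setT (EFin \o v)) :=
  integrable_mul_le1 vi (msinM c) (fun x => sin_max (c * x)).
have ftE q : sqn (ft lebesgue_measure (fun q x : R => q * x) u q) =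
    (cosft u1 q + sinft u2' q) ^+ 2 + (cosft u2' q - sinft u1 q) ^+ 2.
  rewrite /sqn; congr (_ ^+ 2 + _ ^+ 2).
  - transitivity (\int[lebesgue_measure]_x
      complex.Re (u x * expi (- (2 * pi * (q * x))))) => //.
    rewrite /cosft /sinft -RintegralD//; [|exact: icos|exact: isin].
    apply: eq_Rintegral => x _.
    by rewrite complex_ReM/= cosN sinN mulrN opprK mulrA.
  - transitivity (\int[lebesgue_measure]_x
      complex.Im (u x * expi (- (2 * pi * (q * x))))) => //.
    rewrite /cosft /sinft -RintegralB//; [|exact: icos|exact: isin].
    apply: eq_Rintegral => x _.
    by rewrite complex_ImM/= cosN sinN mulrN mulrA addrC.
have cosftN v q : cosft v (- q) = cosft v q.
  by apply: eq_Rintegral => y _; rewrite mulrN mulNr cosN.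
have sinftN (v : R -> R) q : lebesgue_measure.-integrable setT (EFin \o v) ->
   sinft v (- q) = - sinft v q.
  move=> vi; rewrite /sinft -[RHS]mulN1r -RintegralZl//; last exact: isin.
  by apply: eq_Rintegral => y _; rewrite mulrN mulNr sinN mulrN mulN1r.
set g := (X in (\int[_]_q (sqn (X q))%:E)%E).
have mg : measurable_fun setT (fun q => (sqn (g q))%:E).
  exact: measurable_sqn (cmeasurable_ft lebesgue_measure mB (cintegrable_measurable ui)).
have g0 q : (0 <= (sqn (g q))%:E)%E by rewrite lee_fin sqn_ge0.
have mgN : measurable_fun setT (fun q : R => (sqn (g (- q)))%:E).
  exact: (measurableT_comp mg (@oppr_measurable R setT)).
have mS (v : R -> R) : lebesgue_measure.-integrable setT (EFin \o v) ->
    measurable_fun setT (fun q => (cosft v q ^+ 2 + sinft v q ^+ 2)%:E).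
  move=> vi; apply/measurable_EFinP; apply: measurable_funD; apply: measurable_funX.
  + exact: measurable_cosft.
  + exact: measurable_sinft.
have S0 (v : R -> R) q : (0 <= (cosft v q ^+ 2 + sinft v q ^+ 2)%:E)%E.
  by rewrite lee_fin addr_ge0 ?sqr_ge0.
(* The cross terms of [sqn (g q)] are odd in [q]; symmetrizing removes them. *)
have twice : (2%:E * \int[lebesgue_measure]_q (sqn (g q))%:E =
    2%:E * \int[lebesgue_measure]_x (sqn (u x))%:E)%E.
  transitivity (\int[lebesgue_measure]_q ((sqn (g q))%:E + (sqn (g (- q)))%:E))%E.
    rewrite ge0_integralD// (@ge0_integral_opp R (fun q => (sqn (g q))%:E))//.
    by rewrite -[2]/(1 + 1)%R EFinD ge0_muleDl// !mul1e.
  transitivity (\int[lebesgue_measure]_q (2%:E *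
      ((cosft u1 q ^+ 2 + sinft u1 q ^+ 2)%:E +
       (cosft u2' q ^+ 2 + sinft u2' q ^+ 2)%:E)))%E.
    apply: eq_integral => q _; rewrite /g !ftE !cosftN !sinftN//.
    by rewrite -!EFinD -EFinM; congr EFin; ring.
  rewrite ge0_integralZl//; last 2 first.
  - by apply: emeasurable_funD; exact: mS.
  - by move=> q _; exact: adde_ge0.
  rewrite ge0_integralD//; [|exact: mS|exact: mS].
  rewrite !plancherel_real_line//.
  rewrite -ge0_integralD//; try (by move=> x _; rewrite lee_fin sqr_ge0);
    exact: measurable_sqr_EFin.
have := congr1 (fun z => (2^-1)%:E * z)%E twice.
by rewrite !muleA -EFinM mulVf// !mul1e.
Qed.

(** * Transport along an image measure *)

Section pushforward_transport.
Context d1 d2 (T1 : measurableType d1) (T2 : measurableType d2) (R : realType).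
Variable mu : {sigma_finite_measure set T1 -> \bar R}.
Variable nu : {sigma_finite_measure set T2 -> \bar R}.
Variable phi : T1 -> T2.
Hypothesis mphi : measurable_fun setT phi.
Hypothesis nuE : forall A, nu A = pushforward mu phi A.

Lemma ge0_integral_transport (f : T2 -> \bar R) :
  measurable_fun setT f -> (forall x, 0 <= f x)%E ->
  (\int[nu]_x f x = \int[mu]_x f (phi x))%E.
Proof.
move=> mf f0.
unshelve epose (push := pushforward mu phi : {measure set T2 -> \bar R}).
  exact: mphi.
rewrite (@eq_measure_integral _ _ _ _ push); last by move=> A _ _; exact: nuE.
by rewrite ge0_integral_pushforward// preimage_setT.
Qed.

Lemma integrable_transport (f : T2 -> \bar R) :
  nu.-integrable setT f -> mu.-integrable setT (f \o phi).
Proof.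
move=> /integrableP[mf fi]; apply/integrableP; split.
  exact: (measurableT_comp mf).
rewrite -(ge0_integral_transport (f := fun x => `|f x|)%E)//.
exact: measurableT_comp.
Qed.

Lemma integral_transport (f : T2 -> \bar R) :
  nu.-integrable setT f -> (\int[nu]_x f x = \int[mu]_x f (phi x))%E.
Proof.
move=> fi; have mf := measurable_int _ fi.
unshelve epose (push := pushforward mu phi : {measure set T2 -> \bar R}).
  exact: mphi.
rewrite (@eq_measure_integral _ _ _ _ push); last by move=> A _ _; exact: nuE.
rewrite integral_pushforward// preimage_setT//.
exact: integrable_transport.
Qed.

Lemma cintegral_transport (u : T2 -> R[i]) : cintegrable nu u ->
  cintegral nu u = cintegral mu (u \o phi).
Proof. by move=> [u1 u2]; apply: complexP; congr fine; rewrite integral_transport. Qed.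

(** Meant for [tuple_cons], which carries the product measure to the measure on longer tuples and
    the sum of the pairings to [tdot]. *)
Lemma plancherel_transport (B1 : T1 -> T1 -> R) (B2 : T2 -> T2 -> R) :
  measurable_fun setT (fun p : T2 * T2 => B2 p.1 p.2) ->
  (forall q x, B2 (phi q) (phi x) = B1 q x) ->
  plancherel mu B1 -> plancherel nu B2.
Proof.
move=> mB2 B12 [mB1 PL]; split=> // u ui u2.
have mu_ := cintegrable_measurable ui.
have ui' : cintegrable mu (u \o phi).
  by case: ui => u1' u2'; split; [exact: (integrable_transport u1')|
    exact: (integrable_transport u2')].
have sqnE (f : T2 -> R[i]) : cmeasurable f ->
    (\int[nu]_x (sqn (f x))%:E = \int[mu]_x (sqn (f (phi x)))%:E)%E.
  move=> mf; apply: (ge0_integral_transport (f := fun x => (sqn (f x))%:E)).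
  - exact: measurable_sqn.
  - by move=> x; rewrite lee_fin sqn_ge0.
rewrite (sqnE _ (cmeasurable_ft nu mB2 mu_)) (sqnE _ mu_).
rewrite -[RHS]PL//; last by rewrite -(sqnE _ mu_).
apply: eq_integral => q _; congr (sqn _)%:E.
rewrite /ft cintegral_transport; last exact: cintegrable_ft.
by congr cintegral; apply/funext => x /=; rewrite B12.
Qed.

End pushforward_transport.

(** * Plancherel for tuples and for the Heisenberg group *)

Section plancherel_heis.
Variable R : realType.
Local Notation T := (measurableTypeR R).

Lemma measurable_tdot n :
  measurable_fun setT (fun p : n.-tuple T * n.-tuple T => tdot p.1 p.2).
Proof.
apply: measurable_sum => i; apply: measurable_funM.
- exact: (measurableT_comp (measurable_tnth i) measurable_fst).
- exact: (measurableT_comp (measurable_tnth i) measurable_snd).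
Qed.

Lemma tdot_cons n (x y : T * n.-tuple T) :
  tdot (tuple_cons x) (tuple_cons y) = x.1 * y.1 + tdot x.2 y.2.
Proof.
rewrite /tdot big_ord_recl !tnth0; congr (_ + _).
by apply: eq_bigr => i _; rewrite !tnthS.
Qed.

Lemma plancherel_tuple n : plancherel (lebesgue_tuple R n) (@tdot R n).
Proof.
elim: n => [|n IH].
  (* In dimension 0 the measure is a point mass: integrals are evaluations, and the transform
     multiplies by a number of modulus 1. *)
  split; first exact: measurable_tdot.
  move=> u ui _; have mu_ := cintegrable_measurable ui.
  have mf := cmeasurable_ft (lebesgue_tuple R 0) (@measurable_tdot 0) mu_.
  rewrite /= !integral_dirac//; [|exact: measurable_sqn|exact: measurable_sqn].
  rewrite diracT !mul1e; congr EFin.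
  have -> : ft (lebesgue_tuple R 0) (@tdot R 0) u [tuple] =
      u [tuple] * expi (- (2 * pi * tdot [tuple] [tuple])).
    have [m1 m2] := cintegrable_measurable
      (cintegrable_ft (@measurable_tdot 0) [tuple] ui).
    apply: complexP; rewrite /ft /cintegral/= /Rintegral integral_dirac ?diracT ?mul1e//.
    - exact/measurable_EFinP.
    - exact/measurable_EFinP.
  by rewrite sqnM sqn_expi mulr1.
apply: (plancherel_transport (@measurable_tuple_cons R n) _ _ _
  (plancherel_prod (@plancherel_line R) IH)) => //.
- exact: measurable_tdot.
- by move=> q x; rewrite tdot_cons.
Qed.

Lemma hdotE n : @hdot R n = sum_pairing (sum_pairing (@tdot R n) (@tdot R n))
  (fun q x : R => q * x).
Proof. by apply/funext => -[[p q] t]; apply/funext => -[[p' q'] t']. Qed.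

Lemma plancherel_heis n : plancherel (heis_measure R n) (@hdot R n).
Proof.
rewrite hdotE; apply: plancherel_prod; last exact: plancherel_line.
by apply: plancherel_prod; exact: plancherel_tuple.
Qed.

End plancherel_heis.

(** * Translations and balls in the Heisenberg group *)

Section heis_translation.
Variable R : realType.
Local Notation T := (measurableTypeR R).

Lemma measurable_tadd n :
  measurable_fun setT (fun p : n.-tuple T * n.-tuple T => tadd p.1 p.2).
Proof.
apply/measurable_fun_tnthP => i.
rewrite (_ : _ \o _ = fun p : n.-tuple T * n.-tuple T => tnth p.1 i + tnth p.2 i).
  apply: measurable_funD.
  - exact: (measurableT_comp (measurable_tnth i) measurable_fst).
  - exact: (measurableT_comp (measurable_tnth i) measurable_snd).
by apply/funext => p; rewrite /= tnth_mktuple.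
Qed.

Lemma taddC n (p q : n.-tuple T) : tadd p q = tadd q p.
Proof. by apply: eq_from_tnth => i; rewrite !tnth_mktuple addrC. Qed.

Lemma tadd_cons n (x y : T * n.-tuple T) :
  tadd (tuple_cons x) (tuple_cons y) = tuple_cons (x.1 + y.1, tadd x.2 y.2).
Proof.
apply: eq_from_tnth => i; rewrite tnth_mktuple.
case: (unliftP ord0 i) => [j ->|->]; last by rewrite !tnth0.
by rewrite !tnthS tnth_mktuple.
Qed.

Let measurable_tadd1 n (a : n.-tuple T) : measurable_fun setT (tadd a).
Proof. exact: (measurableT_comp (@measurable_tadd n) (pair1_measurable a)). Qed.

(** Follows the recursion of [lebesgue_tuple]: the induction hypothesis translates the tail under
    the integral over the head, then Tonelli exchanges the order and the head is translated on the
    line. *)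
Lemma ge0_integral_tadd n (a : n.-tuple T) (h : n.-tuple T -> \bar R) :
  measurable_fun setT h -> (forall t, 0 <= h t)%E ->
  (\int[lebesgue_tuple R n]_t h (tadd a t) = \int[lebesgue_tuple R n]_t h t)%E.
Proof.
elim: n a h => [|n IH] a h mh h0.
  by apply: eq_integral => t _; rewrite [tadd a t]tuple0 [t]tuple0.
have trans (f : n.+1.-tuple T -> \bar R) : measurable_fun setT f ->
    (forall t, 0 <= f t)%E -> (\int[lebesgue_tuple R n.+1]_t f t =
    \int[sf_prod lebesgue_measure (lebesgue_tuple R n)]_p f (tuple_cons p))%E.
  move=> mf f0; apply: ge0_integral_transport => //.
  exact: measurable_tuple_cons.
have mhc : measurable_fun setT (fun p => h (tuple_cons p)).
  exact: (measurableT_comp mh (@measurable_tuple_cons R n)).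
have mha : measurable_fun setT (fun t => h (tadd a t)).
  exact: (measurableT_comp mh (measurable_tadd1 a)).
rewrite !trans//.
pose a0 := thead a; pose a' := [tuple of behead a].
have aE : a = tuple_cons (a0, a') by rewrite [LHS]tuple_eta; exact: val_inj.
have mF : measurable_fun setT
    (fun p : T * n.-tuple T => h (tuple_cons (a0 + p.1, tadd a' p.2))).
  apply: (measurableT_comp mhc); apply: measurable_fun_pair.
    by apply: measurable_funD => //; exact: measurable_cst.
  exact: (measurableT_comp (measurable_tadd1 a') measurable_snd).
have mF' : measurable_fun setT
    (fun p : T * n.-tuple T => h (tuple_cons (a0 + p.1, p.2))).
  apply: (measurableT_comp mhc); apply: measurable_fun_pair => //.
  by apply: measurable_funD => //; exact: measurable_cst.
transitivity (\int[sf_prod lebesgue_measure (lebesgue_tuple R n)]_p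
    h (tuple_cons ((a0 + p.1)%R, tadd a' p.2)))%E.
  by apply: eq_integral => p _; rewrite {1}aE tadd_cons.
rewrite (sf_tonelli1 lebesgue_measure (lebesgue_tuple R n) mF) => [|p]; last exact: h0.
transitivity (\int[lebesgue_measure]_x \int[lebesgue_tuple R n]_s
    h (tuple_cons ((a0 + x)%R, s)))%E.
  apply: eq_integral => x _ /=.
  apply: (IH a' (fun s => h (tuple_cons ((a0 + x)%R, s)))) => //.
  exact: (measurableT_comp mhc (pair1_measurable _)).
rewrite -(sf_tonelli1 lebesgue_measure (lebesgue_tuple R n) mF' (fun p => h0 _)).
rewrite (sf_tonelli2 lebesgue_measure (lebesgue_tuple R n) mF' (fun p => h0 _)).
rewrite (sf_tonelli2 lebesgue_measure (lebesgue_tuple R n) mhc (fun p => h0 _)).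
apply: eq_integral => s _ /=.
under eq_integral do rewrite addrC.
apply: (@ge0_integral_shift R a0 (fun x => h (tuple_cons (x, s)))) => //.
exact: (measurableT_comp mhc (pair2_measurable _)).
Qed.

(** The common form of left and right Heisenberg translations: the shift of the last coordinate
    depends on the other coordinates alone. Integrating the last coordinate innermost removes it,
    and plain translations remain. *)
Lemma ge0_integral_heis_shear n (a b : n.-tuple T)
    (c : n.-tuple T * n.-tuple T -> R) (h : heis R n -> \bar R) :
  measurable_fun setT c -> measurable_fun setT h -> (forall X, 0 <= h X)%E ->
  (\int[heis_measure R n]_X h (tadd a X.1.1, tadd b X.1.2, (X.2 + c X.1)%R) =
   \int[heis_measure R n]_X h X)%E.
Proof.
move=> mc mh h0.
have mtr : measurable_fun setT (fun p : n.-tuple T * n.-tuple T =>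
    (tadd a p.1, tadd b p.2)).
  apply: measurable_fun_pair.
  - exact: (measurableT_comp (measurable_tadd1 a) measurable_fst).
  - exact: (measurableT_comp (measurable_tadd1 b) measurable_snd).
have mL : measurable_fun setT (fun X : heis R n =>
    h (tadd a X.1.1, tadd b X.1.2, X.2 + c X.1)).
  apply: (measurableT_comp mh); apply: measurable_fun_pair.
  - exact: (measurableT_comp mtr measurable_fst).
  - apply: measurable_funD; first exact: measurable_snd.
    exact: (measurableT_comp mc measurable_fst).
pose G p := (\int[lebesgue_measure]_t h (p, t))%E.
have mG : measurable_fun setT G by exact: measurable_integral_snd.
have G0 p : (0 <= G p)%E by apply: integral_ge0.
rewrite [LHS](sf_tonelli1 _ lebesgue_measure mL (fun X => h0 _)).
rewrite [RHS](sf_tonelli1 _ lebesgue_measure mh h0).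
transitivity (\int[sf_prod (lebesgue_tuple R n) (lebesgue_tuple R n)]_p
    G (tadd a p.1, tadd b p.2))%E.
  apply: eq_integral => p _ /=.
  apply: (@ge0_integral_shift R (c p) (fun t => h (tadd a p.1, tadd b p.2, t))) => //.
  exact: (measurableT_comp mh (pair1_measurable _)).
pose L := lebesgue_tuple R n.
have GE : (\int[sf_prod L L]_p G p = \int[L]_p \int[L]_q G (p, q))%E.
  by rewrite (sf_tonelli1 L L mG).
rewrite [RHS]GE (sf_tonelli1 L L (measurableT_comp mG mtr)) => [|p]; last exact: G0.
pose H p := (\int[lebesgue_tuple R n]_q G (p, q))%E.
have mH : measurable_fun setT H by exact: measurable_integral_snd.
transitivity (\int[lebesgue_tuple R n]_p H (tadd a p))%E.
  apply: eq_integral => p _ /=.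
  apply: (ge0_integral_tadd b (h := fun q => G (tadd a p, q))) => //.
  exact: (measurableT_comp mG (pair1_measurable _)).
by apply: ge0_integral_tadd => // p; exact: integral_ge0.
Qed.

Lemma heis_mulE n (X P : heis R n) : heis_mul X P =
  (tadd X.1.1 P.1.1, tadd X.1.2 P.1.2,
   X.2 + P.2 + 2^-1 * (tdot X.1.1 P.1.2 - tdot X.1.2 P.1.1)).
Proof. by case: X => -[p q] t; case: P => -[p' q'] t'. Qed.

Lemma measurable_heis_mul n :
  measurable_fun setT (fun p : heis R n * heis R n => heis_mul p.1 p.2).
Proof.
under eq_fun do rewrite heis_mulE.
have m11 (i : heis R n * heis R n -> heis R n) : measurable_fun setT i ->
    measurable_fun setT (fun p => (i p).1.1).
  by move=> mi; do 2 apply: measurableT_comp => //.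
have m12 (i : heis R n * heis R n -> heis R n) : measurable_fun setT i ->
    measurable_fun setT (fun p => (i p).1.2).
  by move=> mi; do 2 apply: measurableT_comp => //.
apply: measurable_fun_pair; first apply: measurable_fun_pair.
- by apply: (measurable_fun2 (@measurable_tadd n)); exact: m11.
- by apply: (measurable_fun2 (@measurable_tadd n)); exact: m12.
apply: measurable_funD; first by apply: measurable_funD; exact: measurableT_comp.
apply: measurable_funM; first exact: measurable_cst.
apply: measurable_funB.
- by apply: (measurable_fun2 (@measurable_tdot R n)); [exact: m11|exact: m12].
- by apply: (measurable_fun2 (@measurable_tdot R n)); [exact: m12|exact: m11].
Qed.

Let measurable_tdotr n (a : n.-tuple T) : measurable_fun setT (tdot a).
Proof. exact: (measurableT_comp (@measurable_tdot R n) (pair1_measurable a)). Qed.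

Let measurable_tdotl n (a : n.-tuple T) : measurable_fun setT (fun p => tdot p a).
Proof. exact: (measurableT_comp (@measurable_tdot R n) (pair2_measurable a)). Qed.

(** Left invariance serves Moyal's identity, where [P] varies; right invariance serves the bound at
    fixed [P], where [X] varies. *)
Lemma ge0_integral_heis_mull n (X : heis R n) (h : heis R n -> \bar R) :
  measurable_fun setT h -> (forall P, 0 <= h P)%E ->
  (\int[heis_measure R n]_P h (heis_mul X P) = \int[heis_measure R n]_P h P)%E.
Proof.
move=> mh h0.
pose c (p : n.-tuple T * n.-tuple T) : R :=
  X.2 + 2^-1 * (tdot X.1.1 p.2 - tdot X.1.2 p.1).
have mc : measurable_fun setT c.
  apply: measurable_funD => //; apply: measurable_funM => //.
  apply: measurable_funB.
  - exact: (measurableT_comp (measurable_tdotr _) measurable_snd).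
  - exact: (measurableT_comp (measurable_tdotr _) measurable_fst).
rewrite -(ge0_integral_heis_shear X.1.1 X.1.2 mc mh h0).
apply: eq_integral => P _; rewrite heis_mulE; congr (h (_, _)).
by rewrite /c addrA (addrC X.2).
Qed.

Lemma ge0_integral_heis_mulr n (P : heis R n) (h : heis R n -> \bar R) :
  measurable_fun setT h -> (forall X, 0 <= h X)%E ->
  (\int[heis_measure R n]_X h (heis_mul X P) = \int[heis_measure R n]_X h X)%E.
Proof.
move=> mh h0.
pose c (p : n.-tuple T * n.-tuple T) : R :=
  P.2 + 2^-1 * (tdot p.1 P.1.2 - tdot p.2 P.1.1).
have mc : measurable_fun setT c.
  apply: measurable_funD => //; apply: measurable_funM => //.
  apply: measurable_funB.
  - exact: (measurableT_comp (measurable_tdotl _) measurable_fst).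
  - exact: (measurableT_comp (measurable_tdotl _) measurable_snd).
rewrite -(ge0_integral_heis_shear P.1.1 P.1.2 mc mh h0).
apply: eq_integral => X _; rewrite heis_mulE !(taddC P.1.1) !(taddC P.1.2).
by congr (h (_, _)); rewrite /c addrA.
Qed.

End heis_translation.

Lemma sf_prod_setX d1 d2 (T1 : measurableType d1) (T2 : measurableType d2)
    (R : realType) (m1 : {sigma_finite_measure set T1 -> \bar R})
    (m2 : {sigma_finite_measure set T2 -> \bar R}) A B :
  measurable A -> measurable B ->
  sf_prod m1 m2 (A `*` B) = (m1 A * m2 B)%E.
Proof. exact: product_measure1E. Qed.

(** * Balls of small measure *)

Section heis_ball.
Variable R : realType.
Local Notation T := (measurableTypeR R).

Let tball n : set (n.-tuple T) := [set t | tdot t t <= 1].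

Let tdot_ge0 n (t : n.-tuple T) : 0 <= tdot t t.
Proof. by apply: sumr_ge0 => i _; rewrite -expr2 sqr_ge0. Qed.

Let measurable_tdot_diag n : measurable_fun setT (fun t : n.-tuple T => tdot t t).
Proof. by apply: (measurable_fun2 (@measurable_tdot R n)); exact: measurable_id. Qed.

Let measurable_tball n : measurable (@tball n).
Proof.
rewrite [@tball n](_ : _ = (fun t => tdot t t) @^-1` `]-oo, 1]); last first.
  by apply/seteqP; split => t /=; rewrite in_itv.
by rewrite -[X in measurable X]setTI; apply: measurable_tdot_diag.
Qed.

(** The unit ball lies in [[-1, 1]] times the unit ball of one dimension less. *)
Let tball_finite n : (lebesgue_tuple R n (@tball n) < +oo)%E.
Proof.
elim: n => [|n IH]; first by rewrite /= diracE ltry.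
rewrite [ltLHS](_ : _ = sf_prod lebesgue_measure (lebesgue_tuple R n)
  (@tuple_cons R n @^-1` @tball n.+1))//.
apply: (@le_lt_trans _ _ (sf_prod lebesgue_measure (lebesgue_tuple R n)
    (`[(-1)%R, 1%R]%classic `*` @tball n))).
  apply: le_measure; rewrite ?inE.
  - rewrite -[X in measurable X]setTI; apply: measurable_tuple_cons => //.
    exact: measurable_tball.
  - by apply: measurableX; [exact: measurable_itv|exact: measurable_tball].
  move=> [x t]; rewrite /tball /= tdot_cons/= => xt.
  have := tdot_ge0 t; have := sqr_ge0 x; rewrite in_itv/= => x0 t0.
  split; last by apply: le_trans xt; rewrite lerDr -expr2.
  have x1 : x ^+ 2 <= 1 by apply: le_trans xt; rewrite expr2 lerDl.
  by apply/andP; split; nra.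
rewrite sf_prod_setX//=; last exact: measurable_tball.
rewrite lte_mul_pinfty//; rewrite lebesgue_measure_itv/=; case: ifPn => _ //.
Qed.

Lemma measurable_hdot n :
  measurable_fun setT (fun p : heis R n * heis R n => hdot p.1 p.2).
Proof. by have [] := @plancherel_heis R n. Qed.

Lemma measurable_hnorm n : measurable_fun setT (@hnorm R n).
Proof.
apply: (measurableT_comp (continuous_measurable_fun (@sqrt_continuous R))).
by apply: (measurable_fun2 (@measurable_hdot n)); exact: measurable_id.
Qed.

Definition hball n (r : R) : set (heis R n) := [set X | hnorm X <= r].

Lemma measurable_hball n r : measurable (@hball n r).
Proof.
rewrite [@hball n r](_ : _ = @hnorm R n @^-1` `]-oo, r]); last first.
  by apply/seteqP; split => t /=; rewrite in_itv.
by rewrite -[X in measurable X]setTI; apply: measurable_hnorm.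
Qed.

(** For [r <= 1] the ball lies in the product of two unit balls and [[-r, r]], so the last
    coordinate alone makes the measure small: at most [2 r M^2]. *)
Lemma hball_small n (e : R) : 0 < e ->
  exists2 r : R, 0 < r & (heis_measure R n (@hball n r) <= e%:E)%E.
Proof.
move=> e0; pose M := fine (lebesgue_tuple R n (@tball n)).
have M0 : 0 <= M by exact: fine_ge0.
have ME : lebesgue_tuple R n (@tball n) = M%:E.
  by rewrite fineK// ge0_fin_numE.
have D0 : 0 < 2 * (M * M + 1) by rewrite mulr_gt0// ltr_wpDl// mulr_ge0.
(* The [+ 1] keeps the denominator positive whatever the value of [M]. *)
pose r := Num.min 1 (e / (2 * (M * M + 1))).
have r0 : 0 < r by rewrite lt_min ltr01 divr_gt0.
exists r => //.
apply: (@le_trans _ _ (heis_measure R n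
    ((@tball n `*` @tball n) `*` `[(- r)%R, r]%classic))).
  apply: le_measure; rewrite ?inE.
  - exact: measurable_hball.
  - apply: measurableX; last exact: measurable_itv.
    by apply: measurableX; exact: measurable_tball.
  move=> [[p q] t]; rewrite /hball /hnorm /= => pqt.
  have p0 := tdot_ge0 p; have q0 := tdot_ge0 q; have t0 := sqr_ge0 t.
  have h0 : 0 <= tdot p p + tdot q q + t * t by rewrite -expr2 !addr_ge0.
  have hr : tdot p p + tdot q q + t * t <= r ^+ 2.
    by rewrite -(sqr_sqrtr h0) ler_sqr ?nnegrE ?sqrtr_ge0// ltW.
  have r1 : r <= 1 by rewrite ge_min lexx.
  by split; [split|]; rewrite /tball /= ?in_itv/=; nra.
rewrite [leLHS](_ : _ = (M * M)%:E * (r + r)%:E)%E; last first.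
  have mt := @measurable_tball n.
  transitivity (sf_prod (lebesgue_tuple R n) (lebesgue_tuple R n)
    (@tball n `*` @tball n) * lebesgue_measure `[(- r)%R, r]%classic)%E.
    by apply: sf_prod_setX => //; exact: measurableX.
  rewrite sf_prod_setX//=.
  rewrite ME lebesgue_measure_itv/= lte_fin; case: ifPn => [_|].
    by rewrite -EFinB opprK -EFinM.
  by move/negP; case; rewrite (lt_trans _ r0)// oppr_lt0.
rewrite -EFinM lee_fin.
have : r <= e / (2 * (M * M + 1)) by rewrite ge_min lexx orbT.
rewrite ler_pdivlMr// => rD.
have := mulr_ge0 M0 M0; move: rD; move: (M * M) => k rD k0.
nra.
Qed.

End heis_ball.

(** * The Fourier transform on L^2 *)

Section sqn_integral.
Context d (T : measurableType d) (R : realType).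
Variable mu : {measure set T -> \bar R}.
Implicit Types f g h : T -> R[i].

Lemma normc_ge0 (z : R[i]) : 0 <= normc z.
Proof. by case: z => a b; exact: sqrtr_ge0. Qed.

Lemma normr_Re_le (z : R[i]) : `|complex.Re z| <= normc z.
Proof.
rewrite -ler_sqr ?nnegrE ?normc_ge0// sqn_normc real_normK ?num_real//.
by rewrite lerDl sqr_ge0.
Qed.

Lemma normr_Im_le (z : R[i]) : `|complex.Im z| <= normc z.
Proof.
rewrite -ler_sqr ?nnegrE ?normc_ge0// sqn_normc real_normK ?num_real//.
by rewrite lerDr sqr_ge0.
Qed.

Lemma normc_le (z : R[i]) : normc z <= `|complex.Re z| + `|complex.Im z|.
Proof.
rewrite -ler_sqr ?nnegrE ?normc_ge0 ?addr_ge0// sqn_normc /sqn.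
rewrite -(@real_normK _ (complex.Re z)) ?num_real//.
rewrite -(@real_normK _ (complex.Im z)) ?num_real// sqrrD.
by rewrite lerD2r lerDl mulrn_wge0// mulr_ge0.
Qed.

Lemma measurable_normc f : cmeasurable f ->
  measurable_fun setT (fun x => normc (f x)).
Proof.
move=> mf; rewrite (_ : (fun _ => _) = (fun x => Num.sqrt (sqn (f x)))); last first.
  by apply/funext => x; case: (f x).
apply: (measurableT_comp (continuous_measurable_fun (@sqrt_continuous R))).
exact/measurable_EFinP/measurable_sqn.
Qed.

(** The squared L^2 norm as a bare integral; the square root in [cLnorm] is met only in the
    conversion lemmas. *)
Definition energy f : \bar R := (\int[mu]_x (sqn (f x))%:E)%E.

Lemma energy_ge0 f : (0 <= energy f)%E.
Proof. by apply: integral_ge0 => x _; rewrite lee_fin sqn_ge0. Qed.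

Lemma energyB_sym f g : energy (fun x => f x - g x) = energy (fun x => g x - f x).
Proof. by apply: eq_integral => x _; rewrite -sqnN opprB. Qed.

Lemma energy_triangle f g h : cmeasurable f -> cmeasurable g -> cmeasurable h ->
  (energy (fun x => (f x - h x)%R) <= 2%:E * energy (fun x => (f x - g x)%R) +
    2%:E * energy (fun x => (g x - h x)%R))%E.
Proof.
move=> mf mg mh; rewrite /energy.
have mfg := measurable_sqn (cmeasurableB mf mg).
have mgh := measurable_sqn (cmeasurableB mg mh).
have sqn0 (z : R[i]) : (0 <= (sqn z)%:E)%E by rewrite lee_fin sqn_ge0.
rewrite -!ge0_integralZl// -ge0_integralD//; last 4 first.
- by move=> x _; rewrite mule_ge0.
- exact: measurable_funeM.
- by move=> x _; rewrite mule_ge0.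
- exact: measurable_funeM.
apply: ge0_le_integral => //.
- exact/measurable_sqn/cmeasurableB.
- by apply: emeasurable_funD; exact: measurable_funeM.
move=> x _; rewrite -!EFinM -EFinD lee_fin.
by rewrite (le_trans _ (sqnD_le _ _))// addrA subrK.
Qed.

Lemma energyB0 f : energy (fun x => f x - 0) = energy f.
Proof. by apply: eq_integral => x _; rewrite subr0. Qed.

Lemma energyB_lty f g : cmeasurable f -> cmeasurable g ->
  (energy f < +oo)%E -> (energy g < +oo)%E ->
  (energy (fun x => (f x - g x)%R) < +oo)%E.
Proof.
move=> mf mg f2 g2.
have m0 : cmeasurable (fun _ : T => 0 : R[i]) by split; exact: measurable_cst.
apply: (le_lt_trans (energy_triangle mf m0 mg)).
rewrite energyB0 energyB_sym energyB0.
by rewrite lte_add_pinfty// lte_mul_pinfty.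
Qed.

(** Valid for infinite values as well, which the weighted norms of the theorem may take. *)
Lemma cLnorm2E f : (cLnorm mu 2%:E f ^+ 2)%E = energy f.
Proof.
have sqE (x : \bar R) : (0 <= x)%E -> (x ^+ 2 = x `^ 2)%E.
  case: x => [r r0| |//]; first by rewrite poweR_EFin powR_mulrn// EFin_expe.
  by rewrite poweRyr// expe2 mulyy.
rewrite sqE ?Lnorm_ge0// /cLnorm poweR_Lnorm//; apply: eq_integral => x _.
by rewrite -sqE// abse_EFin ger0_norm ?normc_ge0// -EFin_expe sqn_normc.
Qed.

Lemma cLnorm1E f : cLnorm mu 1%:E f = (\int[mu]_x (normc (f x))%:E)%E.
Proof.
rewrite /cLnorm Lnorm1; apply: eq_integral => x _.
by rewrite abse_EFin ger0_norm ?normc_ge0.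
Qed.

Lemma cLfun1P f : cLfun mu 1%:E f <-> cintegrable mu f.
Proof.
split=> [[m1 m2]|].
  rewrite cLnorm1E => foo; split; apply/integrableP; split; try exact/measurable_EFinP.
  - apply: le_lt_trans foo; apply: ge0_le_integral => //.
    + exact/measurableT_comp/measurable_EFinP.
    + by apply/measurable_EFinP; exact: measurable_normc.
    + by move=> x _; rewrite lee_fin normr_Re_le.
  - apply: le_lt_trans foo; apply: ge0_le_integral => //.
    + exact/measurableT_comp/measurable_EFinP.
    + by apply/measurable_EFinP; exact: measurable_normc.
    + by move=> x _; rewrite lee_fin normr_Im_le.
move=> fi; have mf := cintegrable_measurable fi; have [m1 m2] := mf.
case: fi => /integrableP[_ i1] /integrableP[_ i2]; split=> //; rewrite cLnorm1E.
apply: (@le_lt_trans _ _ (\int[mu]_x (`|(complex.Re (f x))%:E| +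
  `|(complex.Im (f x))%:E|)))%E.
  apply: ge0_le_integral => //.
  - by move=> x _; rewrite lee_fin normc_ge0.
  - by apply/measurable_EFinP; exact: measurable_normc.
  - by apply: emeasurable_funD; exact/measurableT_comp/measurable_EFinP.
  - by move=> x _; rewrite -EFinD lee_fin normc_le.
rewrite ge0_integralD//; try exact/measurableT_comp/measurable_EFinP.
exact: lte_add_pinfty.
Qed.

Lemma cLfun2P f : cLfun mu 2%:E f <-> cmeasurable f /\ (energy f < +oo)%E.
Proof.
have sq_lty : ((cLnorm mu 2%:E f < +oo) = (energy f < +oo))%E.
  rewrite -cLnorm2E; have : (0 <= cLnorm mu 2%:E f)%E by exact: Lnorm_ge0.
  by case: (cLnorm _ _ _) => [r _| |//]; rewrite ?ltry// -EFin_expe ltry.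
by rewrite -sq_lty; split=> [[? ? ?]|[[? ?] ?]].
Qed.

Lemma cvg_cLnorm2P (f : nat -> T -> R[i]) :
  cLnorm mu 2%:E (f k) @[k --> \oo] --> 0%E <->
  energy (f k) @[k --> \oo] --> 0%E.
Proof.
have n0 k : (0 <= cLnorm mu 2%:E (f k))%E by exact: Lnorm_ge0.
split=> f0; apply: cvge0P => [k|e e0]; rewrite ?energy_ge0//.
- have se0 : 0 < Num.sqrt e by rewrite sqrtr_gt0.
  apply: filterS (cvge0_near f0 se0) => k fk.
  rewrite -cLnorm2E -(sqr_sqrtr (ltW e0)) EFin_expe.
  exact: lee_pmul.
- have e20 : 0 < e ^+ 2 by rewrite exprn_gt0.
  apply: filterS (cvge0_near f0 e20) => k; rewrite -cLnorm2E.
  move: (n0 k); case: (cLnorm _ _ _) => [r r0| |//].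
    rewrite -EFin_expe !lee_fin ler_sqr// nnegrE; exact: ltW.
  by rewrite expe2 mulyy leye_eq.
Qed.

End sqn_integral.

(** The increments form an absolutely convergent telescoping series. *)
Lemma cvgn_geometric_increments (R : realType) (a : nat -> R) (c : R) :
  (forall j, `|a j.+1 - a j| <= c * 2^-1 ^+ j) -> cvgn a.
Proof.
move=> ac.
have c0 : 0 <= c by have := le_trans (normr_ge0 _) (ac 0%N); rewrite expr0 mulr1.
have tc : cvgn (series (telescope a)).
  apply: normed_cvg; apply: (series_le_cvg _ _ ac) => [n|n|].
  - exact: normr_ge0.
  - by rewrite mulr_ge0// exprn_ge0.
  - apply: (@is_cvg_geometric_series _ c 2^-1).
    by rewrite ger0_norm// invf_lt1// ltr1n.
rewrite (_ : a = (fun n => a 0%N + series (telescope a) n)).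
  by apply: is_cvgD => //; exact: is_cvg_cst.
by apply/funext => n; rewrite -eq_sum_telescope.
Qed.

Section L2_fourier.
Context d (T : measurableType d) (R : realType).
Variable mu : {sigma_finite_measure set T -> \bar R}.
Implicit Types f h : T -> R[i].

(** Restricts [f] to sets of finite measure that exhaust the space. There [|a| <= a^2 + 1] yields
    integrability, and dominated convergence yields the approximation. *)
Lemma L1_dense_L2 f (e : R) : 0 < e -> cmeasurable f -> (energy mu f < +oo)%E ->
  exists v, [/\ cintegrable mu v, (energy mu v < +oo)%E &
    (energy mu (fun x => (v x - f x)%R) <= e%:E)%E].
Proof.
move=> e0 mf f2; have [mf1 mf2] := mf.
have /sigma_finiteP[F [TF ndF Foo]] := sigma_finiteT mu.
pose v n x : R[i] := f x * (\1_(F n) x)%:C%C.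
have mF n : measurable (F n) by have [] := Foo n.
have m1 n : cmeasurable (fun x => (\1_(F n) x : R)%:C%C).
  by split; [exact: measurable_indic|exact: measurable_cst].
have mv n : cmeasurable (v n) by exact: cmeasurableM.
have sqn1 n x : sqn (\1_(F n) x : R)%:C%C = \1_(F n) x.
  rewrite /sqn/= expr0n addr0 indicE; case: (_ \in _); first exact: expr1n.
  exact: expr0n.
have fi : mu.-integrable setT (fun x => (sqn (f x))%:E).
  apply/integrableP; split; first exact: measurable_sqn.
  by under eq_integral do rewrite gee0_abs ?lee_fin ?sqn_ge0//.
have v2 n : (energy mu (v n) < +oo)%E.
  apply: le_lt_trans f2; apply: ge0_le_integral => //.
  - by move=> x _; rewrite lee_fin sqn_ge0.
  - exact: measurable_sqn.
  - exact: measurable_sqn.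
  - move=> x _; rewrite lee_fin sqnM sqn1 indicE.
    by case: (_ \in _); rewrite ?mulr1// mulr0 sqn_ge0.
have : energy mu (fun x => v n x - f x) @[n --> \oo] --> 0%E.
  have [] // := @dominated_convergence _ _ R mu setT measurableT
    (fun n x => (sqn (v n x - f x))%:E) (cst 0%E) (fun x => (sqn (f x))%:E).
  - by move=> n; exact: measurable_sqn (cmeasurableB (mv n) mf).
  - apply: aeW => x _ /=; apply: cvg_near_cst.
    have : (\bigcup_k F k) x by rewrite -TF.
    move=> [k _ Fkx]; exists k => // n /= kn.
    rewrite /v indicE mem_set ?mulr1 ?subrr; last first.
      by move: x Fkx; exact/subsetPset/ndF.
    by rewrite /sqn/= expr0n addr0.
  - apply: aeW => x n _; rewrite gee0_abs ?lee_fin ?sqn_ge0//.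
    rewrite /v indicE; case: (_ \in _).
      by rewrite mulr1 subrr /sqn/= expr0n addr0 addr_ge0 ?sqr_ge0.
    by rewrite mulr0 sub0r sqnN.
  by move=> _ _; rewrite integral0.
move=> /cvge0_near /(_ _ e0)[k _ /(_ k (leqnn k)) vk].
exists (v k); split => //.
have F1i : mu.-integrable setT (fun x => (\1_(F k) x)%:E).
  apply/integrableP; split; first exact/measurable_EFinP/measurable_indic.
  under eq_integral do rewrite gee0_abs ?lee_fin//.
  by rewrite integral_indic// setIT; have [] := Foo k.
have Di := integrableD measurableT fi F1i.
have le_dom (a : R) (x : T) : a ^+ 2 <= sqn (f x) ->
    (`|(a * \1_(F k) x)%:E| <= `|(sqn (f x))%:E + (\1_(F k) x)%:E|)%E.
  move=> af; rewrite -EFinD !abse_EFin lee_fin [leRHS]ger0_norm; last first.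
    by rewrite addr_ge0 ?sqn_ge0.
  rewrite indicE; case: (_ \in _); last by rewrite mulr0 normr0 addr0 sqn_ge0.
  have a1 : `|a| <= a ^+ 2 + 1.
    rewrite -(real_normK (num_real a)); have := sqr_ge0 (`|a| - 1/2).
    by move: (`|a|) => b; nra.
  by rewrite mulr1 (le_trans a1)// lerD2r.
split; apply: (le_integrable _ _ _ Di) => //.
- by apply/measurable_EFinP; exact: (mv k).1.
- by move=> x _; rewrite complex_ReM/= mulr0 subr0; apply: le_dom; rewrite lerDl sqr_ge0.
- by apply/measurable_EFinP; exact: (mv k).2.
- by move=> x _; rewrite complex_ImM/= mulr0 add0r; apply: le_dom; rewrite lerDr sqr_ge0.
Qed.

Variable B : T -> T -> R.
Hypothesis PL : plancherel mu B.
Let mB := PL.1.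

(** [is_fourier] for an abstract pairing, with energies in place of norms; [is_fourierP] identifies
    the two. *)
Definition is_ft f h := [/\ cmeasurable h, (energy mu h < +oo)%E &
  exists u : nat -> T -> R[i],
  [/\ forall k, cintegrable mu (u k) /\ (energy mu (u k) < +oo)%E,
      energy mu (fun x => u k x - f x) @[k --> \oo] --> 0%E &
      energy mu (fun q => ft mu B (u k) q - h q) @[k --> \oo] --> 0%E]].

Lemma ftB u v q : cintegrable mu u -> cintegrable mu v ->
  ft mu B (fun x => u x - v x) q = ft mu B u q - ft mu B v q.
Proof.
move=> ui vi; have [u1 u2] := cintegrable_ft mB q ui.
have [v1 v2] := cintegrable_ft mB q vi.
apply: complexP.
- rewrite complex_ReB [in RHS]/ft/= -RintegralB//; apply: eq_Rintegral => x _.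
  by rewrite mulrBl complex_ReB.
- rewrite complex_ImB [in RHS]/ft/= -RintegralB//; apply: eq_Rintegral => x _.
  by rewrite mulrBl complex_ImB.
Qed.

Lemma cintegrableB u v : cintegrable mu u -> cintegrable mu v ->
  cintegrable mu (fun x => u x - v x).
Proof.
move=> [u1 u2] [v1 v2]; split.
- by under eq_fun do rewrite complex_ReB EFinB; exact: integrableB.
- by under eq_fun do rewrite complex_ImB EFinB; exact: integrableB.
Qed.

Lemma energy_ftB u v : cintegrable mu u -> cintegrable mu v ->
  (energy mu u < +oo)%E -> (energy mu v < +oo)%E ->
  energy mu (fun q => ft mu B u q - ft mu B v q) =
  energy mu (fun x => u x - v x).
Proof.
move=> ui vi u2 v2; rewrite /energy -[RHS]PL.2.
- by apply: eq_integral => q _; rewrite ftB.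
- exact: cintegrableB.
- exact: (energyB_lty (cintegrable_measurable ui) (cintegrable_measurable vi) u2 v2).
Qed.

(** The inequality |a + b|^2 <= 2 |a|^2 + 2 |b|^2 is used twice, from [f] to [u k] and from the
    transform of [u k] to [h], with exact Plancherel in between; hence the 4. It applies to every
    limit [h], so to the one that [fourier] picks. *)
Lemma le_energy_is_ft f h : cmeasurable f -> is_ft f h ->
  (energy mu f <= 4%:E * energy mu h)%E.
Proof.
move=> mf [mh h2 [u [uk uf ufh]]].
have mu_ k : cmeasurable (u k) by have [i _] := uk k; exact: cintegrable_measurable i.
have mfu k : cmeasurable (ft mu B (u k)) by exact: cmeasurable_ft.
have m0 : cmeasurable (fun _ : T => 0 : R[i]) by split; exact: measurable_cst.
have PLk k : energy mu (ft mu B (u k)) = energy mu (u k).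
  by have [? ?] := uk k; exact: PL.2.
have tri (a b : T -> R[i]) : cmeasurable a -> cmeasurable b ->
    (energy mu a <= 2%:E * energy mu (fun x => (a x - b x)%R) +
      2%:E * energy mu b)%E.
  by move=> ma mb; have := energy_triangle mu ma mb m0; rewrite !energyB0.
(* One error is doubled once and the other twice, and [2 * (e / 6) + 4 * (e / 6) = e]. *)
apply/lee_addgt0Pr => e e0; have e6 : 0 < e / 6 by rewrite divr_gt0.
have [k1 _ uf_le] := cvge0_near uf e6.
have [k2 _ ufh_le] := cvge0_near ufh e6.
pose k := maxn k1 k2.
have {}uf_le := uf_le k (leq_maxl _ _).
have {}ufh_le := ufh_le k (leq_maxr _ _).
have uh : (energy mu (u k) <= 2%:E * (e / 6)%:E + 2%:E * energy mu h)%E.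
  by rewrite -PLk (le_trans (tri _ _ (mfu k) mh))// leeD2r// lee_pmul2l// lte_fin.
have -> : (4%:E * energy mu h + e%:E = 2%:E * (e / 6)%:E +
    2%:E * (2%:E * (e / 6)%:E + 2%:E * energy mu h))%E.
  move: (energy_ge0 mu h) h2; case: (energy mu h) => // r _ _.
  by rewrite -!EFinM -!EFinD; congr EFin; field.
apply: (le_trans (tri _ _ mf (mu_ k))); rewrite energyB_sym.
by apply: leeD; rewrite lee_pmul2l// lte_fin.
Qed.

(** The Riesz-Fischer argument: the transforms of fast L^1 approximants converge almost everywhere,
    and Fatou's lemma turns their mutual distances into distances to the limit. *)
Lemma is_ft_exists f : cmeasurable f -> (energy mu f < +oo)%E ->
  exists h, is_ft f h.
Proof.
move=> mf f2.
(* The rate 8^-j absorbs the weight 4^j of the increments below and still leaves a summable 2^-j. *)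
pose r (j : nat) : R := 8^-1 ^+ j.
have r0 j : 0 < r j by rewrite exprn_gt0.
have r_le j m : (j <= m)%N -> r m <= r j.
  move=> jm; rewrite /r -(subnK jm) exprD ler_piMl ?exprn_ge0//.
  by rewrite exprn_ile1// invf_le1// ler1n.
have /choice[v vP] : forall j, exists v, [/\ cintegrable mu v,
    (energy mu v < +oo)%E & (energy mu (fun x => (v x - f x)%R) <= (r j)%:E)%E].
  by move=> j; exact: L1_dense_L2.
have iv j : cintegrable mu (v j) by have [] := vP j.
have v2 j : (energy mu (v j) < +oo)%E by have [] := vP j.
have vf j : (energy mu (fun x => (v j x - f x)%R) <= (r j)%:E)%E by have [] := vP j.
have mv j : cmeasurable (v j) by exact: cintegrable_measurable (iv j).
pose w j := ft mu B (v j).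
have mw j : cmeasurable (w j) by exact: cmeasurable_ft.
have wB j m : (j <= m)%N ->
    (energy mu (fun x => (w j x - w m x)%R) <= (4 * r j)%:E)%E.
  move=> jm; rewrite energy_ftB//.
  apply: (le_trans (energy_triangle mu (mv j) mf (mv m))).
  have -> : ((4 * r j)%:E = 2%:E * (r j)%:E + 2%:E * (r j)%:E)%E.
    by rewrite -!EFinM -EFinD; congr EFin; ring.
  apply: leeD; rewrite lee_pmul2l// ?lte_fin//.
  rewrite energyB_sym (le_trans (vf m))// lee_fin; exact: r_le.
(* [S x < +oo] forces the increments of [w j x] to be O(2^-j). *)
pose D j x : \bar R := (4 ^+ j * sqn (w j.+1 x - w j x))%:E.
have D0 j x : (0 <= D j x)%E by rewrite lee_fin mulr_ge0 ?exprn_ge0 ?sqn_ge0.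
have mD j : measurable_fun setT (D j).
  apply/measurable_EFinP; apply: measurable_funM => //.
  apply/measurable_EFinP; exact: (measurable_sqn (cmeasurableB (mw _) (mw _))).
pose S x := (\sum_(j <oo) D j x)%E.
have S0 x : (0 <= S x)%E by exact: nneseries_ge0.
have mS : measurable_fun setT S by apply: ge0_emeasurable_sum.
have Soo : (\int[mu]_x S x < +oo)%E.
  rewrite integral_nneseries//.
  (* The [j]-th integral is at most [4^j * 4 * 8^-j = 8 / 2^(j+1)], and these bounds sum to 8. *)
  apply: (@le_lt_trans _ _ 8%:E); last by rewrite ltry.
  apply: le_trans (@epsilon_trick0 R 8 xpredT _) => //.
  apply: lee_nneseries => j _; first by move=> _; apply: integral_ge0.
  have msd := measurable_sqn (cmeasurableB (mw j.+1) (mw j)).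
  have sd0 x : (0 <= (sqn (w j.+1 x - w j x))%:E)%E by rewrite lee_fin sqn_ge0.
  have -> : (\int[mu]_x D j x =
      (4 ^+ j)%:E * energy mu (fun x => (w j.+1 x - w j x)%R))%E.
    by rewrite -ge0_integralZl// lee_fin exprn_ge0.
  have := wB j j.+1 (leqnSn j); rewrite energyB_sym => Hj.
  apply: (@le_trans _ _ ((4 ^+ j)%:E * (4 * r j)%:E)%E).
    by rewrite lee_pmul2l// lte_fin exprn_gt0.
  rewrite -EFinM lee_fin /r natrX exprS exprVn.
  rewrite (_ : 8 = 2 * 4 :> R); last by ring.
  rewrite exprMn.
  have p2 : (2 : R) ^+ j != 0 by rewrite expf_neq0.
  have p4 : (4 : R) ^+ j != 0 by rewrite expf_neq0.
  by rewrite le_eqVlt; apply/orP; left; apply/eqP; field; rewrite p2 p4.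
(* The upper limit is measurable without any convergence and equals the limit wherever there is one;
   [fine] disposes of infinite values. *)
pose hr x : R := fine (limn_esup (fun j => (complex.Re (w j x))%:E)).
pose hi x : R := fine (limn_esup (fun j => (complex.Im (w j x))%:E)).
pose h x : R[i] := Complex (hr x) (hi x).
have mh : cmeasurable h.
  have mfine := @fine_measurable R setT measurableT.
  split; apply: (measurableT_comp mfine); apply: measurable_fun_limn_esup => j;
    apply/measurable_EFinP.
  - exact: (mw j).1.
  - exact: (mw j).2.
have esup_cvg (a : nat -> R) : cvgn a ->
    a n @[n --> \oo] --> fine (limn_esup (fun j => (a j)%:E)).
  move=> /cvg_ex[l al]; have aE : (a j)%:E @[j --> \oo] --> l%:E.
    by apply: cvg_EFin => //; exact: nearW.
  by have [_ ->] := cvg_limn_einf_sup aE.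
have sqrB_cvg (c l : R) (a : nat -> R) : a j @[j --> \oo] --> l ->
    (c - a j) ^+ 2 @[j --> \oo] --> (c - l) ^+ 2.
  move=> al; have cal : (c - a j) @[j --> \oo] --> c - l.
    by apply: cvgB al; exact: cvg_cst.
  by rewrite expr2; under eq_fun do rewrite expr2; exact: cvgM.
have w_cvg : {ae mu, forall x, (complex.Re (w j x) @[j --> \oo] --> hr x) /\
                               (complex.Im (w j x) @[j --> \oo] --> hi x)}.
  have := ae_integral_lty mS S0 Soo; apply: filterS => x Sx.
  have Sfin : S x \is a fin_num by rewrite ge0_fin_numE.
  pose M := fine (S x); have M0 : 0 <= M by exact: fine_ge0.
  have DM j : 4 ^+ j * sqn (w j.+1 x - w j x) <= M.
    rewrite -lee_fin fineK//.
    apply: (@le_trans _ _ (\sum_(0 <= i < j.+1) D i x)%E).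
      by rewrite big_nat_recr//= leeDr// sume_ge0.
    exact: nneseries_lim_ge.
  (* [M + 1] stands in for the square root of [M], since [M <= (M + 1)^2]. *)
  have inc (a : R) j : a ^+ 2 <= sqn (w j.+1 x - w j x) ->
      `|a| <= (M + 1) * 2^-1 ^+ j.
    move=> aj; rewrite -ler_sqr ?nnegrE ?mulr_ge0 ?exprn_ge0 ?addr_ge0//.
    rewrite real_normK ?num_real// (le_trans aj)// exprMn exprAC exprVn.
    rewrite -natrX -[(2 ^ 2)%N]/4%N exprVn ler_pdivlMr ?exprn_gt0// mulrC.
    rewrite (le_trans (DM j))//; nra.
  split; apply: esup_cvg; apply: (@cvgn_geometric_increments _ _ (M + 1)) => j.
  - by apply: inc; rewrite -complex_ReB lerDl sqr_ge0.
  - by apply: inc; rewrite -complex_ImB lerDr sqr_ge0.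
have wh k : (energy mu (fun x => (w k x - h x)%R) <= (4 * r k)%:E)%E.
  (* The shift of the index by [k] makes [wB] available for every [m]. *)
  pose g m x := (sqn (w k x - w (m + k)%N x))%:E.
  have mg m : measurable_fun setT (g m).
    exact: (measurable_sqn (cmeasurableB (mw _) (mw _))).
  have -> : (energy mu (fun x => (w k x - h x)%R) =
             \int[mu]_x limn_einf (g ^~ x))%E.
    apply: ae_eq_integral => //.
    - exact: (measurable_sqn (cmeasurableB (mw _) mh)).
    - apply: measurableT_comp => //; apply: measurable_fun_limn_esup => m.
      exact: measurableT_comp.
    - apply: filterS w_cvg => x [wr wi] _.
      have [-> _] // : (limn_einf (g ^~ x) = (sqn (w k x - h x))%:E) *
                    (limn_esup (g ^~ x) = (sqn (w k x - h x))%:E).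
      apply: cvg_limn_einf_sup; apply: cvg_EFin; first exact: nearW.
      rewrite (@cvg_shiftn k _ (fun m => sqn (w k x - w m x))).
      rewrite (_ : (fun m => _) = (fun m =>
        (complex.Re (w k x) - complex.Re (w m x)) ^+ 2 +
        (complex.Im (w k x) - complex.Im (w m x)) ^+ 2)); last first.
        by apply/funext => m; rewrite /sqn complex_ReB complex_ImB.
      rewrite (_ : sqn _ = (complex.Re (w k x) - hr x) ^+ 2 +
        (complex.Im (w k x) - hi x) ^+ 2); last by rewrite /sqn complex_ReB complex_ImB.
      exact: cvgD (sqrB_cvg _ _ _ wr) (sqrB_cvg _ _ _ wi).
  apply: (le_trans (fatou mu measurableT mg _)).
    by move=> m x _; rewrite lee_fin sqn_ge0.
  rewrite limn_einf_lim; apply: lime_le; first exact: is_cvg_einfs.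
  apply: nearW => m; apply: (@le_trans _ _ (\int[mu]_x g m x)%E).
    by apply: ereal_inf_lbound; exists m => /=.
  by apply: wB; rewrite leq_addl.
have r_cvg (F : nat -> \bar R) (c : R) : 0 < c -> (forall k, 0 <= F k)%E ->
    (forall k, F k <= (c * r k)%:E)%E -> F k @[k --> \oo] --> 0%E.
  move=> c0 F0 Fr; apply: cvge0P => // e e0.
  have /cvgr0Pnorm_le/(_ e e0) : geometric c 8^-1 @ \oo --> (0 : R).
    by apply: cvg_geometric; rewrite ger0_norm// invf_lt1// ltr1n.
  apply: filterS => k; rewrite /= ger0_norm => [ck|]; last first.
    by rewrite mulr_ge0 ?exprn_ge0// ltW.
  by apply: (le_trans (Fr k)); rewrite lee_fin.
exists h; split => //.
- have m0 : cmeasurable (fun _ : T => 0 : R[i]) by split; exact: measurable_cst.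
  have := energy_triangle mu mh (mw 0%N) m0; rewrite !energyB0 => /le_lt_trans; apply.
  have w2 : energy mu (w 0%N) = energy mu (v 0%N)
    by exact: (PL.2 _ (iv 0%N) (v2 0%N)).
  rewrite energyB_sym w2; apply: lte_add_pinfty; apply: lte_mul_pinfty => //.
  exact: le_lt_trans (wh 0%N) (ltry _).
- exists v; split => //.
  + apply: (r_cvg _ 1) => // k; first exact: energy_ge0.
    by rewrite mul1r.
  + by apply: (r_cvg _ 4) => // k; exact: energy_ge0.
Qed.

End L2_fourier.

(** * The short-time Fourier transform *)

(** The real and imaginary parts are each at most [N] in absolute value; estimating them separately
    gives the factor 2. *)
Lemma sqn_cintegral_le d (T : measurableType d) (R : realType)
    (mu : {measure set T -> \bar R}) (f : T -> R[i]) (N : R) :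
  cintegrable mu f -> (\int[mu]_x (normc (f x))%:E <= N%:E)%E ->
  sqn (cintegral mu f) <= 2 * N ^+ 2.
Proof.
move=> fi fN; have mn := measurable_normc (cintegrable_measurable fi).
have [f1 f2] := fi.
have bound (g : T -> R) : mu.-integrable setT (EFin \o g) ->
    (forall x, `|g x| <= normc (f x)) -> (\int[mu]_x g x) ^+ 2 <= N ^+ 2.
  move=> gi gf; have gN : `|\int[mu]_x g x| <= N.
    rewrite (le_trans (le_normr_Rintegral _ gi))// -lee_fin fineK; last first.
      exact/integrable_fin_num/integrable_norm.
    apply: le_trans fN; apply: ge0_le_integral => //.
    - exact: measurable_int (integrable_norm gi).
    - exact/measurable_EFinP.
    - by move=> x _; rewrite lee_fin.
  rewrite -real_normK ?num_real// ler_sqr// nnegrE.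
  exact: le_trans (normr_ge0 _) gN.
rewrite /sqn mulr_natl mulr2n; apply: lerD; apply: bound => // x.
- exact: normr_Re_le.
- exact: normr_Im_le.
Qed.

Section stft_estimates.
Variables (R : realType) (n : nat).
Local Notation mu := (heis_measure R n).
Local Notation H := (heis R n).

Lemma is_fourierP (f h : H -> R[i]) : is_fourier f h <-> is_ft mu (@hdot R n) f h.
Proof.
split.
  move=> [/cLfun2P[mh h2] [u [uk uf uh]]]; split => //.
  exists u; split; [|exact/cvg_cLnorm2P|exact/cvg_cLnorm2P].
  by move=> k; have [/cLfun1P ? /cLfun2P[]] := uk k.
move=> [mh h2 [u [uk uf uh]]]; split; first exact/cLfun2P.
exists u; split; [|exact/cvg_cLnorm2P|exact/cvg_cLnorm2P].
move=> k; have [ui u2] := uk k; split; first exact/cLfun1P.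
by apply/cLfun2P; split => //; exact: cintegrable_measurable ui.
Qed.

(** [xget] returns a member of any inhabited set, and [is_ft_exists] provides an inhabitant. *)
Lemma fourierP (f : H -> R[i]) : cmeasurable f -> (energy mu f < +oo)%E ->
  is_ft mu (@hdot R n) f (fourier f).
Proof.
move=> mf f2; apply/is_fourierP; apply: xgetPex.
have [h hP] := is_ft_exists (plancherel_heis R n) mf f2.
by exists h; exact/is_fourierP.
Qed.

Variables f g : H -> R[i].
Hypotheses (mf : cmeasurable f) (mg : cmeasurable g).
Hypotheses (f2 : (energy mu f < +oo)%E) (g2 : (energy mu g < +oo)%E).

(** In this section [f] and [g] play the role of the Fourier transforms of the functions of the
    theorem, and V_g f at [(Q, P)] is the transform of [F P] at [Q]. *)
Let F (P X : H) : R[i] := f X * conjc (g (heis_mul X P)).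

Let energy_shift P : energy mu (fun X => g (heis_mul X P)) = energy mu g.
Proof.
apply: (ge0_integral_heis_mulr P (h := fun X => (sqn (g X))%:E)).
- exact: measurable_sqn.
- by move=> X; rewrite lee_fin sqn_ge0.
Qed.

Let mF2 : cmeasurable (fun p : H * H => F p.1 p.2).
Proof.
apply: cmeasurableM; first exact: cmeasurable_comp.
apply: cmeasurable_conj; apply: cmeasurable_comp => //.
by apply: (measurable_fun2 (@measurable_heis_mul R n)).
Qed.

Let mF P : cmeasurable (F P).
Proof. exact: cmeasurable_comp mF2 (pair1_measurable P). Qed.

Let mgP P : cmeasurable (fun X => g (heis_mul X P)).
Proof.
apply: cmeasurable_comp mg _.
exact: (measurableT_comp (@measurable_heis_mul R n) (pair2_measurable P)).
Qed.

(** Cauchy-Schwarz in the form [a b <= l b^2 / 2 + a^2 / (2 l)]: the value [l = 1] gives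
    integrability for every [P], and the best [l] recovers the product of the norms. *)
Let normc_F P (l : R) : 0 < l ->
  (\int[mu]_X (normc (F P X))%:E <=
   (l / 2)%:E * energy mu g + (l^-1 / 2)%:E * energy mu f)%E.
Proof.
move=> l0; rewrite -(energy_shift P) /energy.
have ms1 := measurable_sqn (mgP P); have ms2 := measurable_sqn mf.
have s1 X : (0 <= (sqn (g (heis_mul X P)))%:E)%E by rewrite lee_fin sqn_ge0.
have s2 X : (0 <= (sqn (f X))%:E)%E by rewrite lee_fin sqn_ge0.
have l1 : 0 <= l / 2 by rewrite divr_ge0// ltW.
have l2 : 0 <= l^-1 / 2 by rewrite divr_ge0// invr_ge0 ltW.
rewrite -!ge0_integralZl// -ge0_integralD//; last 4 first.
- by move=> x _; rewrite mule_ge0.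
- exact: measurable_funeM.
- by move=> x _; rewrite mule_ge0.
- exact: measurable_funeM.
apply: ge0_le_integral => //.
- by move=> X _; rewrite lee_fin normc_ge0.
- by apply/measurable_EFinP; exact: measurable_normc.
- by apply: emeasurable_funD; exact: measurable_funeM.
move=> X _; rewrite -!EFinM -EFinD lee_fin /F normcM -!sqn_normc.
rewrite (_ : normc (conjc _) = normc (g (heis_mul X P))); last first.
  by case: (g _) => a b; rewrite /normc/= sqrrN.
move: (normc (f X)) (normc (g _)) => a b.
have -> : l / 2 * b ^+ 2 + l^-1 / 2 * a ^+ 2 = a * b + (l * b - a) ^+ 2 / (2 * l).
  by field; rewrite gt_eqF.
by rewrite lerDl divr_ge0 ?sqr_ge0// mulr_ge0// ltW.
Qed.

Let iF P : cintegrable mu (F P).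
Proof.
apply/cLfun1P; have [m1 m2] := mF P; split => //; rewrite cLnorm1E.
apply: (le_lt_trans (normc_F P ltr01)).
by rewrite lte_add_pinfty// lte_mul_pinfty// ?energy_ge0// lee_fin.
Qed.

Definition stft_of (p : H * H) : R[i] := ft mu (@hdot R n) (F p.2) p.1.

Lemma cmeasurable_stft_of : cmeasurable stft_of.
Proof.
apply: (@cmeasurable_cintegral_snd _ _ _ _ _ mu (fun q : (H * H) * H =>
  F q.1.2 q.2 * expi (- (2 * pi * hdot q.1.1 q.2)))).
apply: cmeasurableM.
  apply: (cmeasurable_comp (h := fun q : (H * H) * H => (q.1.2, q.2)) mF2).
  by apply: measurable_fun_pair => //; exact: measurableT_comp.
apply: cmeasurable_expi; apply: measurable_funN; apply: measurable_funM => //.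
by apply: (measurable_fun2 (@measurable_hdot R n)) => //; exact: measurableT_comp.
Qed.

Lemma energy_stft_of :
  energy (sf_prod mu mu) stft_of = (energy mu f * energy mu g)%E.
Proof.
have msV := measurable_sqn cmeasurable_stft_of.
have msF := measurable_sqn mF2.
have sF0 p : (0 <= (sqn (F p.1 p.2))%:E)%E by rewrite lee_fin sqn_ge0.
have sV0 p : (0 <= (sqn (stft_of p))%:E)%E by rewrite lee_fin sqn_ge0.
have EF : (\int[mu]_P energy mu (F P) = energy mu f * energy mu g)%E.
  rewrite -(sf_tonelli1 mu mu msF)// (sf_tonelli2 mu mu msF)//.
  transitivity (\int[mu]_X ((sqn (f X))%:E * energy mu g))%E.
    apply: eq_integral => X _ /=.
    have -> : energy mu g = (\int[mu]_P (sqn (g (heis_mul X P)))%:E)%E.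
      apply/esym; apply: (ge0_integral_heis_mull X (h := fun X => (sqn (g X))%:E)).
      - exact: measurable_sqn.
      - by move=> P; rewrite lee_fin sqn_ge0.
    rewrite -ge0_integralZl//.
    - by apply: eq_integral => P _; rewrite /F sqnM sqn_conj EFinM.
    - apply: (measurableT_comp (measurable_sqn mg)).
      exact: (measurableT_comp (@measurable_heis_mul R n) (pair1_measurable X)).
    - by move=> P _; rewrite lee_fin sqn_ge0.
    - by rewrite lee_fin sqn_ge0.
  rewrite ge0_integralZr//.
  - exact: measurable_sqn.
  - by move=> X _; rewrite lee_fin sqn_ge0.
  - exact: energy_ge0.
have mEF : measurable_fun setT (fun P => energy mu (F P)).
  exact: (measurable_integral_snd mu msF).
rewrite -EF [LHS](sf_tonelli2 mu mu msV sV0).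
apply: ae_eq_integral; [exact: measurableT| |exact: mEF|].
  apply: (@measurable_integral_snd _ _ _ _ _ mu
    (fun p : H * H => (sqn (stft_of (p.2, p.1)))%:E)).
  by apply: (measurableT_comp msV); exact: measurable_fun_pair.
(* [F P] is integrable for every [P]; finiteness of this integral makes it square integrable for
   almost every [P], and Plancherel applies to those. *)
have EFoo : (\int[mu]_P energy mu (F P) < +oo)%E.
  rewrite EF lte_mul_pinfty// ?energy_ge0//.
  by rewrite ge0_fin_numE// energy_ge0.
have := ae_integral_lty mEF (fun P => energy_ge0 mu (F P)) EFoo.
by apply: filterS => P FP _; exact: ((plancherel_heis R n).2 (F P) (iF P) FP).
Qed.

(** The choice [l^2 = a / b] makes the two terms of [normc_F] equal; their sum [l * b] is then the
    geometric mean of the two energies. *)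
Lemma sqn_stft_of_le p (a b : R) : 0 < a -> 0 < b ->
  energy mu f = a%:E -> energy mu g = b%:E -> sqn (stft_of p) <= 2 * (a * b).
Proof.
move=> a0 b0 fa gb; pose l := Num.sqrt (a / b).
have ab0 : 0 < a / b by rewrite divr_gt0.
have l0 : 0 < l by rewrite sqrtr_gt0.
have l2 : l ^+ 2 = a / b by rewrite sqr_sqrtr// ltW.
have -> : a * b = (l * b) ^+ 2 by rewrite exprMn l2; field; rewrite gt_eqF.
apply: sqn_cintegral_le.
  by apply: cintegrable_ft => //; exact: measurable_hdot.
under eq_integral => X _.
  rewrite normcM (_ : normc (expi _) = 1) ?mulr1; last first.
    by rewrite /normc/= cos2Dsin2 sqrtr1.
  over.
apply: (le_trans (normc_F _ l0)); rewrite fa gb -!EFinM -EFinD lee_fin.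
rewrite le_eqVlt; apply/orP; left; apply/eqP.
have -> : a = l ^+ 2 * b by rewrite l2; field; rewrite gt_eqF.
by field; rewrite gt_eqF.
Qed.

End stft_estimates.

Lemma integral_le_split d (T : measurableType d) (R : realType)
    (mu : {measure set T -> \bar R}) (v w1 w2 : T -> R) (A : set T) (c : R) :
  0 <= c -> measurable A ->
  measurable_fun setT v -> measurable_fun setT w1 -> measurable_fun setT w2 ->
  (forall x, 0 <= v x) -> (forall x, 0 <= w1 x) -> (forall x, 0 <= w2 x) ->
  (forall x, v x <= c * \1_A x + (w1 x + w2 x)) ->
  (\int[mu]_x (v x)%:E <=
   c%:E * mu A + (\int[mu]_x (w1 x)%:E + \int[mu]_x (w2 x)%:E))%E.
Proof.
move=> c0 mA mv mw1 mw2 v0 w10 w20 vle.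
have mE (h : T -> R) : measurable_fun setT h ->
  measurable_fun setT (fun x => (h x)%:E) by move=> ?; exact/measurable_EFinP.
have m1 : measurable_fun setT (fun x => c%:E * (\1_A x : R)%:E)%E.
  by apply: measurable_funeM; apply: mE; exact: measurable_indic.
have i0 x : (0 <= c%:E * (\1_A x : R)%:E)%E by rewrite mule_ge0.
have -> : (c%:E * mu A = \int[mu]_x (c%:E * (\1_A x)%:E))%E.
  rewrite ge0_integralZl//; first by rewrite integral_indic// setIT.
  by apply: mE; exact: measurable_indic.
have w12 x : (0 <= (w1 x)%:E + (w2 x)%:E)%E by rewrite adde_ge0 ?lee_fin.
have mw12 : measurable_fun setT (fun x => (w1 x)%:E + (w2 x)%:E)%E.
  by apply: emeasurable_funD; exact: mE.
rewrite -ge0_integralD//; try exact: mE; try by move=> x _; rewrite lee_fin.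
rewrite -ge0_integralD//.
apply: ge0_le_integral => //.
- by move=> x _; rewrite lee_fin.
- exact: mE.
- exact: emeasurable_funD.
- by move=> x _; rewrite -!EFinM -!EFinD lee_fin.
Qed.

Lemma energy_realM d (T : measurableType d) (R : realType)
    (mu : {measure set T -> \bar R}) (c : T -> R) (V : T -> R[i]) :
  energy mu (fun x => (c x)%:C%C * V x) =
  (\int[mu]_x (c x ^+ 2 * sqn (V x))%:E)%E.
Proof. by apply: eq_integral => x _; rewrite sqnM /sqn/= expr0n addr0. Qed.

Lemma energyZ d (T : measurableType d) (R : realType)
    (mu : {measure set T -> \bar R}) (c : R) (V : T -> R[i]) :
  0 <= c -> cmeasurable V ->
  (\int[mu]_x (c * sqn (V x))%:E = c%:E * energy mu V)%E.
Proof.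
move=> c0 mV; rewrite /energy -ge0_integralZl//.
- exact: measurable_sqn.
- by move=> x _; rewrite lee_fin sqn_ge0.
Qed.

(* Outside [hball r `*` hball r] one of the two weights is at least [r `^ s];
   inside, V is bounded and the region has measure at most 1/4. *)
Lemma stft_of_uncertainty (R : realType) (n : nat) (s r : R)
    (f g : heis R n -> R[i]) :
  0 < s -> 0 < r -> (heis_measure R n (@hball R n r) <= (2^-1)%:E)%E ->
  cmeasurable f -> cmeasurable g ->
  (energy (heis_measure R n) f < +oo)%E -> (energy (heis_measure R n) g < +oo)%E ->
  (((r `^ s) ^+ 2 / 2)%:E *
     (energy (heis_measure R n) f * energy (heis_measure R n) g) <=
   energy (sf_prod (heis_measure R n) (heis_measure R n))
     (fun QP => ((hnorm QP.1 `^ s)%:C%C * stft_of f g QP)%R) +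
   energy (sf_prod (heis_measure R n) (heis_measure R n))
     (fun QP => ((hnorm QP.2 `^ s)%:C%C * stft_of f g QP)%R))%E.
Proof.
set mu := heis_measure R n => s0 r0 Br mf mg f2 g2.
(* With a vanishing energy the left-hand side is 0; otherwise both energies are positive reals, as
   the pointwise bound requires. *)
have [fE|f0] := eqVneq (energy mu f) 0%E.
  by rewrite fE mul0e mule0 adde_ge0 ?energy_ge0.
have [gE|g0] := eqVneq (energy mu g) 0%E.
  by rewrite gE mule0 mule0 adde_ge0 ?energy_ge0.
have [a a0 fa] : exists2 a : R, 0 < a & energy mu f = a%:E.
  move: (energy_ge0 mu f) f0 f2; case: (energy mu f) => // a; rewrite lee_fin eqe.
  by move=> a0 an0 _; exists a => //; rewrite lt_neqAle eq_sym an0.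
have [b b0 gb] : exists2 b : R, 0 < b & energy mu g = b%:E.
  move: (energy_ge0 mu g) g0 g2; case: (energy mu g) => // b; rewrite lee_fin eqe.
  by move=> b0 bn0 _; exists b => //; rewrite lt_neqAle eq_sym bn0.
pose V := stft_of f g; pose nu := sf_prod mu mu.
have mV : cmeasurable V by exact: cmeasurable_stft_of.
have msV : measurable_fun setT (fun p => sqn (V p)).
  by apply/measurable_EFinP; exact: measurable_sqn.
pose BB : set (heis R n * heis R n) := @hball R n r `*` @hball R n r.
have mBB : measurable BB by apply: measurableX; exact: measurable_hball.
have nuBB : (nu BB <= (4^-1)%:E)%E.
  have -> : nu BB = (mu (@hball R n r) * mu (@hball R n r))%E.
    by apply: sf_prod_setX; exact: measurable_hball.
  rewrite (_ : 4^-1 = 2^-1 * 2^-1); last by field.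
  by rewrite EFinM lee_pmul.
pose rho := (r `^ s) ^+ 2.
have rho0 : 0 < rho by rewrite exprn_gt0// powR_gt0.
have ab0 : 0 < a * b by rewrite mulr_gt0.
have c0 : 0 <= rho * (2 * (a * b)) by rewrite ltW// mulr_gt0// mulr_gt0.
have mpow (h : heis R n * heis R n -> heis R n) : measurable_fun setT h ->
    measurable_fun setT (fun p => (hnorm (h p) `^ s) ^+ 2 * sqn (V p)).
  move=> mh; apply: measurable_funM => //; apply: measurable_funX.
  apply: (measurableT_comp (measurable_powR s)).
  exact: (measurableT_comp (@measurable_hnorm R n) mh).
have w0 (x : R) p : 0 <= x ^+ 2 * sqn (V p) by rewrite mulr_ge0 ?sqr_ge0 ?sqn_ge0.
have main p : rho * sqn (V p) <= rho * (2 * (a * b)) * \1_BB p +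
    ((hnorm p.1 `^ s) ^+ 2 * sqn (V p) + (hnorm p.2 `^ s) ^+ 2 * sqn (V p)).
  rewrite indicE; have [pB|pB] := boolP (p \in BB).
    rewrite mulr1 (@le_trans _ _ (rho * (2 * (a * b))))//.
      by rewrite (ler_pM2l rho0); exact: sqn_stft_of_le.
    by rewrite lerDl addr_ge0.
  rewrite mulr0 add0r.
  have wi (x : R) : r < x -> rho * sqn (V p) <= (x `^ s) ^+ 2 * sqn (V p).
    move=> rx; rewrite ler_wpM2r ?sqn_ge0// ler_sqr ?nnegrE ?powR_ge0//.
    have x0 : 0 <= x by rewrite ltW// (lt_trans r0).
    by rewrite ge0_ler_powR ?nnegrE// ltW.
  have : r < hnorm p.1 \/ r < hnorm p.2.
    have [p1|] := leP (hnorm p.1) r; last by left.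
    have [p2|] := leP (hnorm p.2) r; last by right.
    by move: pB; rewrite notin_setE; case; split.
  move=> [/wi H|/wi H]; rewrite (le_trans H)//.
  - by rewrite lerDl; exact: w0.
  - by rewrite lerDr; exact: w0.
have mrs : measurable_fun setT (fun p => rho * sqn (V p)).
  exact: measurable_funM.
have rs0 p : 0 <= rho * sqn (V p) by rewrite mulr_ge0 ?sqn_ge0// ltW.
have := integral_le_split nu c0 mBB mrs (mpow _ measurable_fst)
  (mpow _ measurable_snd) rs0 (fun p => w0 _ p) (fun p => w0 _ p) main.
rewrite (energyZ nu (ltW rho0) mV) (energy_stft_of mf mg f2 g2) fa gb.
rewrite -(energy_realM nu (fun p => hnorm p.1 `^ s)).
rewrite -(energy_realM nu (fun p => hnorm p.2 `^ s)) => H.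
(* The product of the balls contributes at most [rho * 2 a b / 4], half of the total [rho * a b];
   the other half is left to the weighted energies. *)
have {}H := le_trans H (leeD2r _ (lee_wpmul2l _ nuBB)).
move: H; set W := (energy _ _ + _)%E.
have : (0 <= W)%E.
  by apply: adde_ge0; exact: energy_ge0.
case: W => [w _|_ _|//]; last by rewrite leey.
move=> /(_ c0); rewrite -!EFinM -EFinD !lee_fin -/rho.
lra.
Qed.

(** The factor 4 of [le_energy_is_ft], taken for each of the two functions, turns 1/2 into 1/32. *)
Lemma lee_mul_quarter (R : realType) (c : R) (x y x' y' : \bar R) :
  0 < c -> (0 <= x)%E -> (0 <= y)%E ->
  (x <= 4%:E * x')%E -> (y <= 4%:E * y')%E ->
  ((c / 32)%:E * x * y <= (c / 2)%:E * (x' * y'))%E.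
Proof.
move=> c0 x0 y0 xx' yy'; rewrite -muleA.
apply: (@le_trans _ _ ((c / 32)%:E * ((4%:E * x') * (4%:E * y')))%E).
  rewrite lee_pmul2l ?lte_fin//; last by rewrite divr_gt0.
  exact: lee_pmul.
have -> : ((c / 2)%:E = (c / 32)%:E * (4%:E * 4%:E))%E.
  by rewrite -!EFinM; congr EFin; field.
by rewrite [in leLHS]muleACA [leLHS]muleA.
Qed.

Theorem theorem8p1 (R : realType) (n : nat) (hn : (1 <= n)%N) (s : R)
    (hs : 0 < s) :
  exists2 C : R, 0 < C &
    forall f g : heis R n -> R[i],
      cLfun (heis_measure R n) 2%:E f ->
      cLfun (heis_measure R n) 2%:E g ->
      (cLnorm (sf_prod (heis_measure R n) (heis_measure R n)) 2%:E
         (fun QP => (hnorm QP.1 `^ s)%:C%C * stft g f QP.1 QP.2)%R ^+ 2 +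
       cLnorm (sf_prod (heis_measure R n) (heis_measure R n)) 2%:E
         (fun QP => (hnorm QP.2 `^ s)%:C%C * stft g f QP.1 QP.2)%R ^+ 2
       >= C%:E * cLnorm (heis_measure R n) 2%:E f ^+ 2
               * cLnorm (heis_measure R n) 2%:E g ^+ 2)%E.
Proof.
have half0 : 0 < 2^-1 :> R by [].
(* Two balls of measure 1/2 have a product of measure 1/4, where the pointwise bound 2 leaves half
   of the mass. The radius depends only on [n]; [s] enters through the power r^s. *)
have [r r0 Br] := @hball_small R n 2^-1 half0.
have rs0 : 0 < (r `^ s) ^+ 2 by rewrite exprn_gt0// powR_gt0.
exists ((r `^ s) ^+ 2 / 32); first by rewrite divr_gt0.
move=> f g /cLfun2P[mf f2] /cLfun2P[mg g2].
have ftf := fourierP mf f2; have ftg := fourierP mg g2.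
have [mfh fh2 _] := ftf; have [mgh gh2 _] := ftg.
have lef := le_energy_is_ft (plancherel_heis R n) mf ftf.
have leg := le_energy_is_ft (plancherel_heis R n) mg ftg.
have le_st := stft_of_uncertainty hs r0 Br mfh mgh fh2 gh2.
rewrite -2!(cLnorm2E (sf_prod (heis_measure R n) (heis_measure R n))) in le_st.
apply: le_trans le_st; rewrite (cLnorm2E _ f) (cLnorm2E _ g).
exact: (lee_mul_quarter rs0 (energy_ge0 _ _) (energy_ge0 _ _) lef leg).
Qed.
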